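(* Let $I=\{1,\dots,N\}$ and let $\mathbb P$ be a fully supported Bernoulli measure on $\Omega=I^{\mathbb N}$. Fix $1<a<b<\infty$, $\eta>0$, and complex numbers $(\beta_\kappa)_{\kappa\in I}$ with $\beta_1=1$ and $$\frac{\log a}{\log b+\pi}\le|\beta_\kappa|\le\frac{\log b+\pi}{\log a},\quad\kappa\in I.$$ Fix $0<p_{\min}\le p_{\max}<1$, let $H=A_{a,b,\eta}\times[p_{\min},p_{\max}]$, and fix $\alpha>0$. Then there exist a Borel set $\mathcal G_{H,\alpha}\subset\Omega\times A_{a,b,\eta}$ and a constant $\sigma=\sigma(H,\alpha)>0$ such that: (i) for $\mathbb P$-a.e. $\omega$, $\dim_H\{\theta\in A_{a,b,\eta}:(\omega,\theta)\notin\mathcal G_{H,\alpha}\}\le\alpha$; (ii) if $(\omega,\theta)\in\mathcal G_{H,\alpha}$ and $\Sigma=((\Phi^{(i)})_{i\in I},(p_i)_{i\in I},\mathbb P)$ is a non-degenerate planar model such that $k_1\ge2$, $t^{(1)}_j\ne t^{(1)}_{j'}$ for some $j,j'\in\{1,\dots,k_1\}$, $p^{(1)}_j\in[p_{\min},p_{\max}]$ for all $j\in\{1,\dots,k_1\}$, and for each $\kappa\in I$ the maps $f^{(\kappa)}_j$ have linear part $\lambda_\kappa=\theta^{-\beta_\kappa}=e^{-\beta_\kappa\log\theta}$ with $a\le|\lambda_\kappa|^{-1}\le b$, then $\eta^{(\omega)}\in\mathcal D_2(\sigma)$.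
   Context: $A_{a,b,\eta}=\{z\in\mathbb C:a\le|z|\le b,\ \mathrm{Im}(z)>\eta\}$. $\log$ is the principal branch of the logarithm (imaginary part in $(-\pi,\pi]$). A planar model $\Sigma=((\Phi^{(i)})_{i\in I},(p_i)_{i\in I},\mathbb P)$: for each $i\in I$, $\Phi^{(i)}=(f^{(i)}_1,\dots,f^{(i)}_{k_i})$ with $f^{(i)}_j(z)=\lambda_i z+t^{(i)}_j$, $0<|\lambda_i|<1$; $p_i=(p^{(i)}_j)_j$ a probability vector with positive entries. The random measure $\eta^{(\omega)}$ is the law of $\sum_{n\ge1}(\prod_{j=1}^{n-1}\lambda_{\omega_j})t^{(\omega_n)}_{u_n}$ with $u_n$ independent with laws $p_{\omega_n}$. Non-degenerate: some $i_0$ with $\mathbb P(\omega_1=i_0)>0$ has not all maps of $\Phi^{(i_0)}$ equal. $\widehat\mu(\xi)=\int e^{2\pi i\,\mathrm{Re}(z\bar\xi)}d\mu(z)$, $\mathcal D_2(\sigma)=\{\mu:|\widehat\mu(\xi)|=O_\mu(|\xi|^{-\sigma})\}$. *)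

(* Defs.v *)
(* Complex numbers are modelled as pairs (R * R)
   (real part, imaginary part), carrying the product (= Borel) sigma-algebra. *)
From HB Require Import structures.
From mathcomp Require Import all_boot all_order all_algebra.
From mathcomp Require Import all_classical all_reals all_analysis.
Set Implicit Arguments. Unset Strict Implicit. Unset Printing Implicit Defensive.
Import Order.TTheory GRing.Theory Num.Theory.
Import numFieldNormedType.Exports.
Local Open Scope classical_set_scope.
Local Open Scope ring_scope.

(* ordinals 'I_n.+1 are pointed (needed to build sequence spaces) *)
HB.instance Definition _ (n : nat) := isPointed.Build 'I_n.+1 ord0.

Section Complex.
Variable R : realType.
Definition cplx := (R * R)%type.
Definition Cone : cplx := (1, 0).
Definition Cneg (z : cplx) : cplx := (- z.1, - z.2).
Definition Cmul (z w : cplx) : cplx :=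
  (z.1 * w.1 - z.2 * w.2, z.1 * w.2 + z.2 * w.1).
Definition Cnorm (z : cplx) : R := Num.sqrt (z.1 ^+ 2 + z.2 ^+ 2).
(* principal argument, in (-pi, pi] *)
Definition Carg (z : cplx) : R :=
  if z == (0, 0) then 0 else
  if 0 <= z.2 then acos (z.1 / Cnorm z) else - acos (z.1 / Cnorm z).
Definition Clog (z : cplx) : cplx := (ln (Cnorm z), Carg z).
Definition Cexp (z : cplx) : cplx := (expR z.1 * cos z.2, expR z.1 * sin z.2).
Definition Cdist (z w : cplx) : R := Cnorm (z.1 - w.1, z.2 - w.2).
Definition annulus (a b eta : R) : set cplx :=
  [set z | a <= Cnorm z <= b /\ eta < z.2].

Definition diam (U : set cplx) : \bar R :=
  ereal_sup [set r | exists x y, U x /\ U y /\ r = (Cdist x y)%:E].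
Definition hterm (s : R) (U : set cplx) : R :=
  if `[< U = set0 >] then 0 else (fine (diam U)) `^ s.
Definition hcontent (s delta : R) (E : set cplx) : \bar R :=
  ereal_inf [set (\sum_(n <oo) (hterm s (F n))%:E)%E | F in
    [set F : nat -> set cplx |
       E `<=` \bigcup_n F n /\ forall n, (diam (F n) <= delta%:E)%E]].
Definition hmeasure (s : R) (E : set cplx) : \bar R :=
  ereal_sup [set hcontent s delta E | delta in [set delta : R | 0 < delta]].
Definition hdim (E : set cplx) : \bar R :=
  ereal_inf [set s%:E | s in [set s : R | 0 <= s /\ hmeasure s E = 0%E]].
End Complex.

Definition cyl (T : Type) : set (set (nat -> T)) :=
  [set A | exists n (w : nat -> T),
     A = [set x | forall m, (m < n)%N -> x m = w m]].

(* Omega = I^N with I = 'I_N.+1 (index ord0 plays the role of the paper's 1),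
   with the cylinder sigma-algebra *)
Definition OmegaT (N : nat) := g_sigma_algebraType (@cyl 'I_N.+1).
(* space of choices of maps u = (u_n), u_n in nat *)
Definition USpace := g_sigma_algebraType (@cyl nat).

Section Model.
Variables (R : realType) (N : nat).
Local Notation I := 'I_N.+1.

Definition bernoulli_law (q : I -> R) (P : probability (OmegaT N) R) :=
  forall n (w : nat -> I),
    P [set x : OmegaT N | forall m, (m < n)%N -> x m = w m]
      = (\prod_(m < n) q (w m))%:E.

(* planar model: Phi^(i) = (z |-> lam i * z + t i j)_{j < k i},
   p i = (p i j)_{j < k i} probability vector with positive entries *)
Definition planar_model (k : I -> nat) (lam : I -> cplx R)
    (t : I -> nat -> cplx R) (p : I -> nat -> R) :=
  forall i, 0 < Cnorm (lam i) < 1 /\ (forall j, (j < k i)%N -> 0 < p i j)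
            /\ \sum_(j < k i) p i j = 1.

Definition model_nondegenerate (P : probability (OmegaT N) R) (k : I -> nat)
    (t : I -> nat -> cplx R) :=
  exists i0, (0 < P [set x : OmegaT N | x 0%N = i0])%E /\
    exists j j', [/\ (j < k i0)%N, (j' < k i0)%N & t i0 j <> t i0 j'].

(* Q is the law of the independent sequence (u_n), u_n ~ p_{omega_n} *)
Definition coding_law (k : I -> nat) (p : I -> nat -> R) (omega : nat -> I)
    (Q : probability USpace R) :=
  forall n (v : nat -> nat),
    Q [set u : USpace | forall m, (m < n)%N -> u m = v m]
      = (\prod_(m < n) (if (v m < k (omega m))%N then p (omega m) (v m) else 0))%:E.

Definition lamprod (lam : I -> cplx R) (omega : nat -> I) (n : nat) : cplx R :=
  \big[@Cmul R/Cone R]_(m < n) lam (omega m).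

(* the random point sum_{n>=1} (prod_{j<n} lam_{omega_j}) t^{(omega_n)}_{u_n}
   (0-indexed) *)
Definition rpoint (lam : I -> cplx R) (t : I -> nat -> cplx R)
    (omega : nat -> I) (u : nat -> nat) : cplx R :=
  let term n := Cmul (lamprod lam omega n) (t (omega n) (u n)) in
  (limn (fun N0 => \sum_(n < N0) (term n).1),
   limn (fun N0 => \sum_(n < N0) (term n).2)).
End Model.

Section Fourier.
Variable R : realType.
(* | hat(eta)(xi) | where eta is the law of X under Q:
   hat(eta)(xi) = E_Q[ exp(2 pi i Re(X conj(xi))) ] *)
Definition law_fourier_abs (Q : probability USpace R) (X : USpace -> cplx R)
    (xi : cplx R) : R :=
  let ph u := 2 * pi * ((X u).1 * xi.1 + (X u).2 * xi.2) in
  Num.sqrt ((Rintegral Q setT (fun u => cos (ph u))) ^+ 2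
          + (Rintegral Q setT (fun u => sin (ph u))) ^+ 2).

Definition fourier_decay (F : cplx R -> R) (sigma : R) :=
  exists C : R, forall xi : cplx R, 1 <= Cnorm xi -> F xi <= C * (Cnorm xi) `^ (- sigma).
End Fourier.

(* Main.v *)
(* An Erdos-Kahane argument.  Since the u_n are independent, |hat eta^(omega)(xi)|
   is a product over n; when omega_n = 1 the n-th factor is bounded away from 1
   as soon as the real part of x_n = (prod_(m < n) lambda_(omega_m)) x_0 is far
   from the integers, where x_0 = (t_j - t_j') conj(xi).  Cut time into blocks of
   fixed length L.  In a run 1111 of omega the numbers Re x_n satisfy a linear
   recurrence whose coefficients are 2 Re theta and |theta|^2, so if they are all
   very close to integers, these integers determine theta up to O(1/|x_n|) and
   x_n up to O(1); reading time backwards from |x_n| ~ 1, the integers of one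
   block are in turn determined by what is known at the end of that block.  Only
   the blocks without a run and the blocks where some Re x_n is far from the
   integers leave a choice, of at most exp(O(L)) cells each.  Hence the parameters
   theta that have at most J/e such bad blocks among the first J are covered by
   few balls of radius about a^(-JL): for e large their limsup set has dimension
   at most alpha.  For L large, almost every omega has at most J/(2e) blocks
   without a run (Chernoff and Borel-Cantelli), so that every other theta gets at
   least J/(2e) contracting factors, with J comparable to log |xi|. *)

Require Import Defs.
From HB Require Import structures.
From mathcomp Require Import all_boot all_order all_algebra.
From mathcomp Require Import all_classical all_reals all_analysis.
From mathcomp Require Import measurable_realfun ring lra zify.
Set Implicit Arguments. Unset Strict Implicit. Unset Printing Implicit Defensive.
Import Order.TTheory GRing.Theory Num.Theory.
Import numFieldNormedType.Exports.
Local Open Scope classical_set_scope.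
Local Open Scope ring_scope.

(** What is carried backwards in time is a pair of errors: the error on x_n, and the error on theta
    multiplied by |x_n|. In this scaling both grow by at most a fixed factor B per step, whatever
    the letter. A tolerance delta at the end of a block stays below 1/2 throughout it, so two orbits
    near integers there share these integers; the run then cuts the error to O(rho), which is still
    below delta at the start of the block. A good block therefore leaves no choice at all. A bad
    block costs a factor exponential in L, and L must be large depending on e for runs to be
    frequent. This is not circular: the cells of J/e bad blocks number at most C^(JL/e) with C
    independent of L, against balls of radius about a^(-JL). So e is fixed before L, then delta and
    rho. Covers are built for pairs (theta, x), because the good set may not depend on the
    translations, which enter only through x. The good set is defined by avoiding these covers
    rather than the bad parameters, whose definition quantifies over all x; balls chosen from finite
    prefixes of omega are plainly Borel. *)

Section ComplexPlane.
Variable R : realType.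
Implicit Types z w u : cplx R.

Lemma CmulA : associative (@Cmul R).
Proof. by move=> z w u; rewrite /Cmul /=; congr pair; ring. Qed.

Lemma CmulC : commutative (@Cmul R).
Proof. by move=> z w; rewrite /Cmul /=; congr pair; ring. Qed.

Lemma Cmul1z : left_id (Cone R) (@Cmul R).
Proof. by case=> x y; rewrite /Cmul /Cone /=; congr pair; ring. Qed.

Lemma Cnorm_sqr z : Cnorm z ^+ 2 = z.1 ^+ 2 + z.2 ^+ 2.
Proof. by rewrite sqr_sqrtr// addr_ge0 ?sqr_ge0. Qed.

Lemma Cnorm_ge0 z : 0 <= Cnorm z.
Proof. exact: sqrtr_ge0. Qed.

Lemma CnormM z w : Cnorm (Cmul z w) = Cnorm z * Cnorm w.
Proof.
rewrite /Cnorm -sqrtrM ?addr_ge0 ?sqr_ge0// /Cmul /=; congr Num.sqrt; ring.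
Qed.

Lemma Cnorm1 : Cnorm (Cone R) = 1.
Proof. by rewrite /Cnorm /= expr1n expr0n /= addr0 sqrtr1. Qed.

Lemma Cnorm_re z : `|z.1| <= Cnorm z.
Proof.
rewrite -(@ler_pXn2r _ 2)// ?nnegrE ?Cnorm_ge0// Cnorm_sqr real_normK ?num_real//.
by rewrite lerDl sqr_ge0.
Qed.

Lemma Cnorm_im z : `|z.2| <= Cnorm z.
Proof.
rewrite -(@ler_pXn2r _ 2)// ?nnegrE ?Cnorm_ge0// Cnorm_sqr real_normK ?num_real//.
by rewrite lerDr sqr_ge0.
Qed.

Lemma Cnorm_le_sum z : Cnorm z <= `|z.1| + `|z.2|.
Proof.
rewrite -(@ler_pXn2r _ 2)// ?nnegrE ?Cnorm_ge0 ?addr_ge0// Cnorm_sqr sqrrD.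
rewrite !real_normK ?num_real// -addrA lerD2l lerDr mulrn_wge0// mulr_ge0//.
Qed.

Lemma Cnorm_add z w : Cnorm (z.1 + w.1, z.2 + w.2) <= Cnorm z + Cnorm w.
Proof.
rewrite -(@ler_pXn2r _ 2)// ?nnegrE ?Cnorm_ge0 ?addr_ge0 ?Cnorm_ge0//.
rewrite Cnorm_sqr [leRHS]sqrrD !Cnorm_sqr /=.
have h : z.1 * w.1 + z.2 * w.2 <= Cnorm z * Cnorm w.
  rewrite (le_trans (ler_norm _))//.
  rewrite -(@ler_pXn2r _ 2)// ?nnegrE ?mulr_ge0 ?Cnorm_ge0//.
  rewrite exprMn !Cnorm_sqr real_normK ?num_real//.
  rewrite -subr_ge0.
  have -> : (z.1 ^+ 2 + z.2 ^+ 2) * (w.1 ^+ 2 + w.2 ^+ 2)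
    - (z.1 * w.1 + z.2 * w.2) ^+ 2 = (z.1 * w.2 - z.2 * w.1) ^+ 2 by ring.
  exact: sqr_ge0.
lra.
Qed.

Lemma CdistC z w : Cdist z w = Cdist w z.
Proof. by rewrite /Cdist /Cnorm /=; congr Num.sqrt; ring. Qed.

Lemma Cdist_ge0 z w : 0 <= Cdist z w.
Proof. exact: Cnorm_ge0. Qed.

Lemma Cdist_tri u z w : Cdist z w <= Cdist z u + Cdist u w.
Proof.
rewrite {1}/Cdist; have := Cnorm_add (z.1 - u.1, z.2 - u.2) (u.1 - w.1, u.2 - w.2).
rewrite /= => h; apply: le_trans h; rewrite le_eqVlt; apply/orP; left; apply/eqP.
by congr Cnorm; congr pair; ring.
Qed.

Lemma Cnorm_le_dist z w : Cnorm z <= Cnorm w + Cdist z w.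
Proof.
have := Cnorm_add w (z.1 - w.1, z.2 - w.2); rewrite /= !subrKC.
by case: z.
Qed.

Lemma Cnorm_dist z w : `|Cnorm z - Cnorm w| <= Cdist z w.
Proof.
by rewrite ler_norml; have := Cnorm_le_dist z w; have := Cnorm_le_dist w z;
  rewrite (CdistC w z) => h1 h2; apply/andP; split; lra.
Qed.

Lemma Cdist_re z w : `|z.1 - w.1| <= Cdist z w.
Proof. exact: (Cnorm_re (z.1 - w.1, z.2 - w.2)). Qed.

Lemma Cdist_im z w : `|z.2 - w.2| <= Cdist z w.
Proof. exact: (Cnorm_im (z.1 - w.1, z.2 - w.2)). Qed.

Lemma Cdist_le_sum z w : Cdist z w <= `|z.1 - w.1| + `|z.2 - w.2|.
Proof. exact: (Cnorm_le_sum (z.1 - w.1, z.2 - w.2)). Qed.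

Lemma Cdist_mull u z w : Cdist (Cmul u z) (Cmul u w) = Cnorm u * Cdist z w.
Proof.
by rewrite /Cdist -CnormM; congr Cnorm; rewrite /Cmul /=; congr pair; ring.
Qed.

Lemma Cdist_mul z w z' w' :
  Cdist (Cmul z w) (Cmul z' w') <= Cdist z z' * Cnorm w + Cnorm z' * Cdist w w'.
Proof.
apply: le_trans (Cdist_tri (Cmul z' w) _ _) _; rewrite lerD//.
  by rewrite (CmulC z) (CmulC z') Cdist_mull mulrC.
by rewrite Cdist_mull.
Qed.

Lemma Cnorm_exp z : Cnorm (Cexp z) = expR z.1.
Proof.
rewrite /Cnorm /Cexp /= !exprMn -mulrDr cos2Dsin2 mulr1 sqrtr_sqr.
by rewrite ger0_norm// expR_ge0.
Qed.

Lemma Cexp_add z w : Cmul (Cexp z) (Cexp w) = Cexp (z.1 + w.1, z.2 + w.2).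
Proof.
by rewrite /Cmul /Cexp /= expRD cosD sinD; congr pair; ring.
Qed.

Lemma Cexp_neg z : Cmul (Cexp (Cneg z)) (Cexp z) = Cone R.
Proof.
by rewrite Cexp_add /Cneg /= !addNr /Cexp /= expR0 cos0 sin0 mulr1 mulr0.
Qed.

Lemma cos_lip (x y : R) : `|cos x - cos y| <= `|x - y|.
Proof.
wlog xy : x y / x <= y => [h|].
  by case: (leP x y) => [/h//|/ltW/h]; rewrite distrC (distrC x).
have D t : t \in `]x, y[%R -> is_derive t 1 (@cos R) (- sin t).
  by move=> _; apply: is_derive_cos.
have C : {within `[x, y], continuous (@cos R)}.
  by apply: continuous_subspaceT => t; apply: continuous_cos.
have [c _] := MVT_segment xy D C; rewrite distrC (distrC x) => ->; rewrite normrM normrN ler_piMl//.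
by rewrite ler_norml sin_geN1 sin_le1.
Qed.

Lemma sin_lip (x y : R) : `|sin x - sin y| <= `|x - y|.
Proof.
wlog xy : x y / x <= y => [h|].
  by case: (leP x y) => [/h//|/ltW/h]; rewrite distrC (distrC x).
have D t : t \in `]x, y[%R -> is_derive t 1 (@sin R) (cos t).
  by move=> _; apply: is_derive_sin.
have C : {within `[x, y], continuous (@sin R)}.
  by apply: continuous_subspaceT => t; apply: continuous_sin.
have [c _] := MVT_segment xy D C; rewrite distrC (distrC x) => ->; rewrite normrM ler_piMl//.
by rewrite ler_norml cos_geN1 cos_le1.
Qed.

Lemma expR_lip (B x y : R) : expR x <= B -> expR y <= B ->
  `|expR x - expR y| <= B * `|x - y|.
Proof.
wlog xy : x y / x <= y => [h|].
  by case: (leP x y) => [/h//|/ltW/h + p q] => /(_ q p); rewrite distrC (distrC x).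
move=> _ yB; rewrite distrC (distrC x) !ger0_norm ?subr_ge0 ?ler_expR//.
have := expR_ge1Dx (x - y); rewrite expRD expRN => h.
have h2 : expR y * (1 + (x - y)) <= expR x.
  rewrite -ler_pdivlMl ?expR_gt0//; rewrite mulrC; exact: h.
have : expR y * (y - x) <= B * (y - x) by rewrite ler_wpM2r ?subr_ge0.
lra.
Qed.

Lemma Cexp_lip (B : R) z w : Cnorm (Cexp z) <= B -> Cnorm (Cexp w) <= B ->
  Cdist (Cexp z) (Cexp w) <= 4 * B * Cdist z w.
Proof.
rewrite !Cnorm_exp => zB wB.
have B0 : 0 <= B := le_trans (expR_ge0 _) zB.
have key f : (forall x y : R, `|f x - f y| <= `|x - y|) -> (forall x, `|f x| <= 1) ->
  `|expR z.1 * f z.2 - expR w.1 * f w.2| <= 2 * B * Cdist z w.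
  move=> flip f1.
  have -> : expR z.1 * f z.2 - expR w.1 * f w.2 =
    (expR z.1 - expR w.1) * f z.2 + expR w.1 * (f z.2 - f w.2) by ring.
  rewrite (le_trans (ler_normD _ _))// !normrM (ger0_norm (expR_ge0 w.1)).
  have h1 : `|expR z.1 - expR w.1| * `|f z.2| <= B * Cdist z w.
    rewrite -[leRHS]mulr1 ler_pM//.
    by rewrite (le_trans (expR_lip zB wB))// ler_wpM2l// Cdist_re.
  have h2 : expR w.1 * `|f z.2 - f w.2| <= B * Cdist z w.
    by rewrite ler_pM// ?expR_ge0// (le_trans (flip _ _))// Cdist_im.
  lra.
have k1 := key _ cos_lip (fun x => ltac:(by rewrite ler_norml cos_geN1 cos_le1)).
have k2 := key _ sin_lip (fun x => ltac:(by rewrite ler_norml sin_geN1 sin_le1)).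
by have := Cdist_le_sum (Cexp z) (Cexp w); rewrite /Cexp /= in k1 k2 *; lra.
Qed.

(** Mean value theorem: the slope has modulus (1 - t^2)^(-1/2), and 1 - t^2 is concave, so its lower
    bound at the two endpoints persists between them. *)
Lemma acos_lip (m x y : R) : 0 < m -> m ^+ 2 <= 1 - x ^+ 2 -> m ^+ 2 <= 1 - y ^+ 2 ->
  `|acos x - acos y| <= m^-1 * `|x - y|.
Proof.
move=> m0; wlog xy : x y / x <= y => [h|].
  by case: (leP x y) => [/h//|/ltW/h + p q] => /(_ q p); rewrite distrC (distrC x).
move=> mx my.
have m20 : 0 < m ^+ 2 by rewrite exprn_gt0.
have bnd t : t \in `[x, y] -> m ^+ 2 <= 1 - t ^+ 2 /\ -1 < t < 1.
  rewrite in_itv /= => /andP[xt ty].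
  have mt : m ^+ 2 <= 1 - t ^+ 2.
    by case: (leP 0 t) => t0; nra.
  by split => //; apply/andP; split; nra.
have D t : t \in `]x, y[%R -> is_derive t 1 (@acos R) (- (Num.sqrt (1 - t ^+ 2))^-1).
  by move=> txy; apply: is_derive1_acos; have [] := bnd t (subset_itv_oo_cc txy).
have C : {within `[x, y], continuous (@acos R)}.
  apply: continuous_in_subspaceT => t; rewrite inE => /= txy.
  by apply: continuous_acos; have [] := bnd t txy.
have [c cxy] := MVT_segment xy D C; rewrite distrC (distrC x) => ->; rewrite normrM normrN ler_wpM2r//.
have [mc _] := bnd c cxy.
have s0 : 0 < Num.sqrt (1 - c ^+ 2) by rewrite sqrtr_gt0 (lt_le_trans m20).
rewrite gtr0_norm ?invr_gt0// lef_pV2 ?posrE//.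
rewrite -(@ler_pXn2r _ 2)//; last 2 first.
- by rewrite nnegrE ltW.
- by rewrite nnegrE ltW.
by rewrite sqr_sqrtr// (le_trans (ltW m20)).
Qed.

Lemma ln_lip (x y : R) : 1 <= x -> 1 <= y -> `|ln x - ln y| <= `|x - y|.
Proof.
wlog xy : x y / x <= y => [h|].
  by case: (leP x y) => [/h//|/ltW/h + p q] => /(_ q p); rewrite distrC (distrC x).
move=> x1 y1; have x0 : 0 < x by lra. have y0 : 0 < y by lra.
rewrite distrC (distrC x) !ger0_norm ?subr_ge0 ?ler_ln ?posrE//.
rewrite -ln_div ?posrE//.
have h : ln (y / x) <= y / x - 1.
  have q0 : 0 < y / x by rewrite divr_gt0.
  have e : y / x = 1 + (y / x - 1) by ring.
  by rewrite {1}e; apply: le_ln1Dx; lra.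
apply: le_trans h _.
have -> : y / x - 1 = (y - x) / x by rewrite mulrBl divff ?gt_eqF.
by rewrite ler_pdivrMr// ler_peMr// subr_ge0.
Qed.

Lemma annulus_bounds (a b eta : R) z : annulus a b eta z ->
  [/\ a <= Cnorm z, Cnorm z <= b & eta < z.2].
Proof. by case=> /andP[]. Qed.

Implicit Types (a b eta : R) (th : cplx R).

(** The right side is the squared sine of the argument, (Im th / |th|)^2. It keeps [acos] away from
    its singular points -1 and 1; this is where Im th > eta makes the logarithm Lipschitz. *)
Lemma annulus_unit_re a b eta th : 1 < a -> a < b -> 0 < eta ->
  annulus a b eta th ->
  (eta / b) ^+ 2 <= 1 - (th.1 / Cnorm th) ^+ 2.
Proof.
move=> a1 ab eta0 /annulus_bounds[ath thb h].
have n0 : 0 < Cnorm th by lra. have b0 : 0 < b by lra.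
have -> : 1 - (th.1 / Cnorm th) ^+ 2 = (th.2 / Cnorm th) ^+ 2.
  rewrite !expr_div_n; have -> : 1 = Cnorm th ^+ 2 / Cnorm th ^+ 2 :> R.
    by rewrite divff// expf_neq0 ?gt_eqF.
  by rewrite -mulrBl Cnorm_sqr addrC addKr.
have t0 : 0 < th.2 by lra.
rewrite ler_pXn2r// ?nnegrE ?(ltW (divr_gt0 _ _))//.
by rewrite ler_pM ?invr_ge0 ?lef_pV2 ?posrE ?(ltW h) ?(ltW eta0) ?(ltW b0).
Qed.

Lemma Clog_annulus a b eta th : 0 < eta ->
  annulus a b eta th ->
  Clog th = (ln (Cnorm th), acos (th.1 / Cnorm th)).
Proof.
move=> eta0 /annulus_bounds[_ _ h]; rewrite /Clog /Carg; case: eqP => [e|_].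
  by move: (lt_trans eta0 h); rewrite e /= ltxx.
by have -> : 0 <= th.2 by lra.
Qed.

Lemma CexpK a b eta th : 1 < a -> a < b -> 0 < eta ->
  annulus a b eta th -> Cexp (Clog th) = th.
Proof.
move=> a1 ab eta0 H; rewrite (Clog_annulus eta0 H).
have [ath thb h] := annulus_bounds H.
have n0 : 0 < Cnorm th by lra.
have m := annulus_unit_re a1 ab eta0 H.
have m0 : 0 <= (eta / b) ^+ 2 by rewrite sqr_ge0.
have u1 : -1 <= th.1 / Cnorm th <= 1 by apply/andP; split; nra.
rewrite /Cexp /= lnK ?posrE// acosK ?in_itv//= sin_acos//.
have -> : 1 - (th.1 / Cnorm th) ^+ 2 = (th.2 / Cnorm th) ^+ 2.
  rewrite !expr_div_n; have -> : 1 = Cnorm th ^+ 2 / Cnorm th ^+ 2 :> R.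
    by rewrite divff// expf_neq0 ?gt_eqF.
  by rewrite -mulrBl Cnorm_sqr addrC addKr.
have t0 : 0 < th.2 by lra.
rewrite sqrtr_sqr gtr0_norm ?divr_gt0//.
by rewrite !mulrA ![_ * th.1]mulrC ![_ * th.2]mulrC !mulfK ?gt_eqF//; case: (th).
Qed.

(** The 1 comes from [ln] on moduli at least 1; b / eta is the slope of [acos], and the 2 is a
    Lipschitz constant of th.1 / |th|. *)
Lemma Clog_lip a b eta th th' : 1 < a -> a < b -> 0 < eta ->
  annulus a b eta th -> annulus a b eta th' ->
  Cdist (Clog th) (Clog th') <= (1 + 2 * (b / eta)) * Cdist th th'.
Proof.
move=> a1 ab eta0 H H'; have m := annulus_unit_re a1 ab eta0 H; have m' := annulus_unit_re a1 ab eta0 H'.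
rewrite (Clog_annulus eta0 H) (Clog_annulus eta0 H').
have [ath thb h] := annulus_bounds H; have [ath' thb' h'] := annulus_bounds H'.
have n0 : 0 < Cnorm th by lra. have n0' : 0 < Cnorm th' by lra.
have b0 : 0 < b by lra.
apply: le_trans (Cdist_le_sum _ _) _ => /=.
have r := Cnorm_dist th th'.
have h1 : `|ln (Cnorm th) - ln (Cnorm th')| <= Cdist th th'.
  by apply: le_trans (ln_lip _ _) r; lra.
have h2 : `|th.1 / Cnorm th - th'.1 / Cnorm th'| <= 2 * Cdist th th'.
  have -> : th.1 / Cnorm th - th'.1 / Cnorm th' = (th.1 - th'.1) / Cnorm th
      + th'.1 * (Cnorm th' - Cnorm th) / (Cnorm th * Cnorm th').
    by field; rewrite !gt_eqF.
  rewrite (le_trans (ler_normD _ _))// !normrM !normfV !normrM.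
  rewrite (gtr0_norm n0) (gtr0_norm n0').
  have e1 : `|th.1 - th'.1| / Cnorm th <= Cdist th th'.
    rewrite ler_pdivrMr// (le_trans (Cdist_re _ _))// ler_peMr ?Cdist_ge0//; lra.
  have e2 : `|th'.1| * `|Cnorm th' - Cnorm th| / (Cnorm th * Cnorm th') <= Cdist th th'.
    rewrite ler_pdivrMr ?mulr_gt0// distrC.
    rewrite [leRHS]mulrA [leRHS]mulrC ler_pM// ?Cnorm_re//.
    by rewrite (le_trans r)// ler_peMr ?Cdist_ge0//; lra.
  lra.
have m0 : 0 < eta / b by rewrite divr_gt0.
have h3 : `|acos (th.1 / Cnorm th) - acos (th'.1 / Cnorm th')|
   <= b / eta * (2 * Cdist th th').
  apply: le_trans (acos_lip m0 m m') _; rewrite invf_div ler_wpM2l//.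
  by rewrite ltW// divr_gt0.
lra.
Qed.

End ComplexPlane.

HB.instance Definition _ (R : realType) := Monoid.isComLaw.Build
  (cplx R) (Cone R) (@Cmul R) (@CmulA R) (@CmulC R) (@Cmul1z R).

(** * The orbit of a frequency *)

Section Orbit.
Variables (R : realType) (N : nat) (beta : 'I_N.+1 -> cplx R).
Local Notation I := 'I_N.+1.
Implicit Types (a b eta M B D : R) (th : cplx R) (s : cplx R * cplx R).
Implicit Types om : nat -> I.

Definition contraction th (i : I) : cplx R := Cexp (Cmul (Cneg (beta i)) (Clog th)).
Definition expansion th (i : I) : cplx R := Cexp (Cmul (beta i) (Clog th)).

(* For s = (theta, x), the frequency seen after n steps of the model with
   parameter theta, started from the frequency x. *)
Definition orbit om n s : cplx R := Cmul (lamprod (contraction s.1) om n) s.2.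

(** The annulus controls only the letter [ord0], whose expansion is theta itself when [beta ord0] is
    1; for the other letters the bounds come from the condition a <= |lambda|^-1 <= b imposed on the
    model. *)
Definition admissible (a b eta : R) th :=
  annulus a b eta th /\ forall i, a <= Cnorm (expansion th i) <= b.

Lemma contractionK th i : Cmul (contraction th i) (expansion th i) = Cone R.
Proof.
rewrite /contraction /expansion.
have -> : Cmul (Cneg (beta i)) (Clog th) = Cneg (Cmul (beta i) (Clog th)).
  by rewrite /Cmul /Cneg /=; congr pair; ring.
exact: Cexp_neg.
Qed.

Lemma Cnorm_contraction th i : (Cnorm (contraction th i))^-1 = Cnorm (expansion th i).
Proof.
have := congr1 (@Cnorm R) (contractionK th i); rewrite CnormM Cnorm1 => h.
have e0 : Cnorm (contraction th i) != 0.
  by apply/eqP => e; move: h; rewrite e mul0r => /esym/eqP; rewrite oner_eq0.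
by rewrite -[RHS](mulKf e0) h mulr1.
Qed.

Lemma lamprodS (lam : I -> cplx R) om n :
  lamprod lam om n.+1 = Cmul (lamprod lam om n) (lam (om n)).
Proof. by rewrite /lamprod big_ord_recr. Qed.

Lemma orbit0 om s : orbit om 0 s = s.2.
Proof. by rewrite /orbit /lamprod big_ord0 Cmul1z. Qed.

Lemma orbitS om n s : orbit om n s = Cmul (expansion s.1 (om n)) (orbit om n.+1 s).
Proof.
rewrite /orbit lamprodS [in RHS]CmulC -!CmulA; congr Cmul.
by rewrite (CmulC s.2) CmulA contractionK Cmul1z.
Qed.

Lemma eq_orbit om om' n s : (forall m, (m < n)%N -> om m = om' m) ->
  orbit om n s = orbit om' n s.
Proof.
move=> h; rewrite /orbit /lamprod; congr Cmul; apply: eq_bigr => i _.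
by rewrite h.
Qed.

Lemma orbit_growth a b eta om n k s : 0 < a -> admissible a b eta s.1 ->
  a ^+ k * Cnorm (orbit om (n + k) s) <= Cnorm (orbit om n s)
    <= b ^+ k * Cnorm (orbit om (n + k) s).
Proof.
move=> a0 [_ adm]; elim: k => [|k /andP[ih1 ih2]].
  by rewrite addn0 !expr0 !mul1r lexx.
have /andP[h1 h2] := adm (om (n + k)%N).
have o0 := Cnorm_ge0 (orbit om (n + k.+1) s).
have b0 : 0 <= b by apply: le_trans h2; exact: Cnorm_ge0.
move: ih1 ih2; rewrite orbitS CnormM addnS => ih1 ih2; apply/andP; split.
  apply: le_trans ih1; rewrite exprSr -mulrA.
  by rewrite ler_wpM2l ?exprn_ge0 ?(ltW a0)// ler_wpM2r// Cnorm_ge0.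
apply: le_trans ih2 _; rewrite exprSr -mulrA.
by rewrite ler_wpM2l ?exprn_ge0// ler_wpM2r// Cnorm_ge0.
Qed.

(** The weight |x_n| in the second clause makes the relation stable under backward steps, and at
    time 0, where the frequency is large, turns it into exponential closeness of the parameters. *)
Definition close om n (D : R) s s' :=
  Cdist (orbit om n s) (orbit om n s') <= D /\
  Cdist s.1 s'.1 * Cnorm (orbit om n s) <= D.

Lemma close_le om n D D' s s' : D <= D' -> close om n D s s' -> close om n D' s s'.
Proof. by move=> DD' [h1 h2]; split; apply: le_trans DD'. Qed.

Lemma expansion_lip a b eta M th th' i : 1 < a -> a < b -> 0 < eta ->
  Cnorm (beta i) <= M -> admissible a b eta th -> admissible a b eta th' ->
  Cdist (expansion th i) (expansion th' i)
    <= 4 * b * (M * (1 + 2 * (b / eta))) * Cdist th th'.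
Proof.
move=> a1 ab eta0 bM [A1 A2] [A1' A2'].
have /andP[_ h] := A2 i; have /andP[_ h'] := A2' i.
have b0 : 0 <= 4 * b by lra.
apply: le_trans (Cexp_lip h h') _; rewrite Cdist_mull -[leRHS]mulrA ler_wpM2l//.
have l := Clog_lip a1 ab eta0 A1 A1'.
by rewrite -[leRHS]mulrA ler_pM// ?Cnorm_ge0 ?Cdist_ge0.
Qed.

(** One backward step writes E x - E' x' as (E - E') x + E' (x - x'). The first term is a Lipschitz
    constant times |theta - theta'| |x|, which the second clause of [close] bounds by D; the second
    is at most b D. [B] absorbs the sum. *)
Lemma close_back a b eta M B om n k D s s' : 1 < a -> a < b -> 0 < eta ->
  (forall i, Cnorm (beta i) <= M) ->
  b + 4 * b * (M * (1 + 2 * (b / eta))) <= B ->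
  admissible a b eta s.1 -> admissible a b eta s'.1 ->
  close om (n + k) D s s' -> close om n (B ^+ k * D) s s'.
Proof.
move=> a1 ab eta0 hM hB adm adm'.
elim: k D => [|k ih] D; first by rewrite addn0 expr0 mul1r.
rewrite addnS => -[h1 h2]; rewrite exprSr -mulrA; apply: ih.
have lip := expansion_lip a1 ab eta0 (hM (om (n + k)%N)) adm adm'.
have [_ /(_ (om (n + k)%N))/andP[e1 e2]] := adm.
have [_ /(_ (om (n + k)%N))/andP[e1' e2']] := adm'.
have D0 : 0 <= D := le_trans (Cdist_ge0 _ _) h1.
have M0 : 0 <= M := le_trans (Cnorm_ge0 _) (hM ord0).
have L0 : 0 <= 4 * b * (M * (1 + 2 * (b / eta))).
  have be : 0 <= b / eta by rewrite divr_ge0; lra.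
  by rewrite !mulr_ge0//; lra.
split; rewrite orbitS.
  rewrite (orbitS _ _ s'); apply: le_trans (Cdist_mul _ _ _ _) _.
  set d1 := Cdist (expansion _ _) _ in lip *; set d := Cdist s.1 s'.1 in lip h2 *.
  set x := Cnorm (orbit om _ s) in h2 *; set y := Cdist (orbit _ _ _) _ in h1 *.
  set e' := Cnorm (expansion s'.1 _) in e2' *.
  have x0 : 0 <= x by exact: Cnorm_ge0.
  have p1 : d1 * x <= 4 * b * (M * (1 + 2 * (b / eta))) * D.
    by apply: le_trans (ler_wpM2r x0 lip) _; rewrite -[leLHS]mulrA ler_wpM2l.
  have p2 : e' * y <= b * D by rewrite ler_pM ?Cnorm_ge0 ?Cdist_ge0.
  have p3 := ler_wpM2r D0 hB.
  by move: p1 p2 p3; rewrite mulrDl; lra.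
rewrite CnormM mulrCA.
apply: le_trans (_ : b * D <= _).
  by rewrite ler_pM ?Cnorm_ge0 ?mulr_ge0 ?Cdist_ge0 ?Cnorm_ge0.
by rewrite ler_wpM2r//; lra.
Qed.

End Orbit.

(** * Recovering the parameter from four consecutive real parts *)

Section Run.
Variable R : realType.
Implicit Types (th u : cplx R).

(** [c0] bounds the error on 2 Re theta: (1 + b)^3 comes from Cramer's rule and eta^2 from the
    determinant. [c1] bounds the error on theta. The remaining terms are the errors on the real and
    the imaginary part of u. *)
Definition run_const (b eta : R) : R :=
  let c0 := (1 + b) ^+ 3 / eta ^+ 2 in
  let c1 := c0 * (1 + b / eta) in
  c1 + 1 + (1 + b + 2 * c1) / eta.

Lemma run_const_gt0 (b eta : R) : 0 < b -> 0 < eta -> 0 < run_const b eta.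
Proof.
move=> b0 e0; have be : 0 < b / eta by rewrite divr_gt0.
have c0 : 0 < (1 + b) ^+ 3 / eta ^+ 2 by rewrite divr_gt0 ?exprn_gt0//; lra.
have c1 : 0 < (1 + b) ^+ 3 / eta ^+ 2 * (1 + b / eta) by rewrite mulr_gt0//; lra.
rewrite /run_const; have : 0 < (1 + b + 2 * ((1 + b) ^+ 3 / eta ^+ 2 * (1 + b / eta))) / eta.
  by rewrite divr_gt0//; lra.
lra.
Qed.

Lemma ler_wM_norm (x y X Y : R) : `|x| <= X -> `|y| <= Y -> `|x * y| <= X * Y.
Proof. by move=> h1 h2; rewrite normrM ler_pM. Qed.

(* With T = 2 Re th and D = |th|^2, the numbers r_i = Re (th^i u) satisfy
   r_(i+2) = T r_(i+1) - D r_i, and r_1^2 - r_0 r_2 = (Im th)^2 |u|^2: the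
   linear system for (T, D) is uniformly invertible. *)
Lemma run_close (a b eta e : R) th th' u u' : 1 < a -> a < b -> 0 < eta ->
  annulus a b eta th -> annulus a b eta th' ->
  `|u.1 - u'.1| <= e ->
  `|(Cmul th u).1 - (Cmul th' u').1| <= e ->
  `|(Cmul th (Cmul th u)).1 - (Cmul th' (Cmul th' u')).1| <= e ->
  `|(Cmul th (Cmul th (Cmul th u))).1 - (Cmul th' (Cmul th' (Cmul th' u'))).1| <= e ->
  Cdist u u' <= run_const b eta * e /\
  Cdist th th' * Cnorm u <= run_const b eta * e.
Proof.
move=> a1 ab eta0 /annulus_bounds[ath thb h] /annulus_bounds[ath' thb' h'].
have b0 : 0 < b := lt_trans (lt_trans ltr01 a1) ab.
have b1 : 0 <= 1 + b by rewrite addr_ge0// ltW.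
have t0 : 0 < th.2 := lt_trans eta0 h. have t0' : 0 < th'.2 := lt_trans eta0 h'.
have s0 : 0 <= th.2 + th'.2 by rewrite addr_ge0// ltW.
have s2 : 2 * eta <= th.2 + th'.2 by move: h h'; clear; lra.
have nh : `|(th.1 + th'.1) / 2| <= b.
  have := Cnorm_re th; have := Cnorm_re th'; rewrite !ler_norml.
  by move=> /andP[? ?] /andP[? ?]; apply/andP; split; lra.
have e0 x : `|x| <= e -> 0 <= e by apply: le_trans.
move=> d0 d1 d2 d3; move/e0: (d0) => {}e0.
set r0 := u.1 in d0; set r0' := u'.1 in d0.
set r1 := (Cmul th u).1 in d1; set r1' := (Cmul th' u').1 in d1.
set r2 := (Cmul th (Cmul th u)).1 in d2; set r2' := (Cmul th' (Cmul th' u')).1 in d2.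
set r3 := (Cmul th (Cmul th (Cmul th u))).1 in d3.
set r3' := (Cmul th' (Cmul th' (Cmul th' u'))).1 in d3.
set n := Cnorm u; have n0 : 0 <= n by exact: Cnorm_ge0.
pose T := 2 * th.1; pose T' := 2 * th'.1.
pose D := th.1 ^+ 2 + th.2 ^+ 2; pose D' := th'.1 ^+ 2 + th'.2 ^+ 2.
have rec2 : r2 = T * r1 - D * r0 by rewrite /r2 /r1 /r0 /T /D /Cmul /=; ring.
have rec3 : r3 = T * r2 - D * r1 by rewrite /r3 /r2 /r1 /T /D /Cmul /=; ring.
have rec2' : r2' = T' * r1' - D' * r0' by rewrite /r2' /r1' /r0' /T' /D' /Cmul /=; ring.
have rec3' : r3' = T' * r2' - D' * r1' by rewrite /r3' /r2' /r1' /T' /D' /Cmul /=; ring.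
have nT' : `|T'| <= 2 * b.
  rewrite normrM ger0_norm// ler_wpM2l// (le_trans (Cnorm_re _))//.
have nD' : `|D'| <= b ^+ 2.
  rewrite /D' -Cnorm_sqr ger0_norm ?sqr_ge0// ler_pXn2r ?nnegrE ?Cnorm_ge0//; exact: ltW.
pose E1 := (T - T') * r1 - (D - D') * r0.
pose E2 := (T - T') * r2 - (D - D') * r1.
have bE x0 x1 x2 x : x = (x2 - T' * x1 + D' * x0) -> `|x0| <= e -> `|x1| <= e -> `|x2| <= e ->
    `|x| <= (1 + b) ^+ 2 * e.
  move=> -> h0 h1 h2.
  apply: le_trans (ler_normD _ _) _; have k0 := ler_wM_norm nD' h0.
  have := ler_normB x2 (T' * x1); have k1 := ler_wM_norm nT' h1.
  by move: k0 k1; lra.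
have bE1 : `|E1| <= (1 + b) ^+ 2 * e.
  by apply: (bE (r0 - r0') (r1 - r1') (r2 - r2')) => //; rewrite /E1 rec2 rec2'; ring.
have bE2 : `|E2| <= (1 + b) ^+ 2 * e.
  by apply: (bE (r1 - r1') (r2 - r2') (r3 - r3')) => //; rewrite /E2 rec3 rec3'; ring.
have nr0 : `|r0| <= n by exact: Cnorm_re.
have nr1 : `|r1| <= b * n.
  by rewrite (le_trans (Cnorm_re _))// CnormM ler_wpM2r.
have nr2 : `|r2| <= b * (b * n).
  rewrite (le_trans (Cnorm_re _))// !CnormM ler_pM ?mulr_ge0 ?Cnorm_ge0//.
  by rewrite ler_wpM2r.
have det : r1 ^+ 2 - r0 * r2 = th.2 ^+ 2 * n ^+ 2.
  by rewrite /n Cnorm_sqr /r0 /r1 /r2 /Cmul /=; ring.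
have sol1 : (T - T') * (th.2 ^+ 2 * n ^+ 2) = r1 * E1 - r0 * E2.
  by rewrite -det /E1 /E2; ring.
have sol2 : (D - D') * (th.2 ^+ 2 * n ^+ 2) = r2 * E1 - r1 * E2.
  by rewrite -det /E1 /E2; ring.
have eta2 : 0 < eta ^+ 2 by rewrite exprn_gt0.
(* The determinant carries |u|^2 and the numerators only |u|, so the error on theta comes out
   multiplied by |u|, as [close] requires. If u = 0 the claim is trivial. *)
have cancel x c : 0 <= c -> `|x * (th.2 ^+ 2 * n ^+ 2)| <= c * n -> `|x| * n <= c / eta ^+ 2.
  move=> c0; rewrite normrM (ger0_norm (mulr_ge0 (sqr_ge0 _) (sqr_ge0 _))) => hx.
  case: (ltP 0 n) => [npos|]; last first.
    move=> nle; have -> : n = 0 by apply: le_anti; rewrite nle n0.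
    by rewrite mulr0 divr_ge0// ltW.
  rewrite ler_pdivlMr// -(ler_pM2r npos); apply: le_trans hx.
  have : eta ^+ 2 <= th.2 ^+ 2 by rewrite lerXn2r ?nnegrE ?(ltW eta0) ?(ltW t0) ?(ltW h).
  move=> /(ler_wpM2r (mulr_ge0 (normr_ge0 x) (sqr_ge0 n))) k.
  have -> : `|x| * n * eta ^+ 2 * n = eta ^+ 2 * (`|x| * n ^+ 2) by ring.
  have -> : `|x| * (th.2 ^+ 2 * n ^+ 2) = th.2 ^+ 2 * (`|x| * n ^+ 2) by ring.
  exact: k.
pose c0 := (1 + b) ^+ 3 / eta ^+ 2.
have dT : `|T - T'| * n <= c0 * e.
  rewrite /c0 mulrAC; apply: cancel; first by rewrite mulr_ge0// exprn_ge0.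
  rewrite sol1 (le_trans (ler_normB _ _))//.
  have k1 := ler_wM_norm nr1 bE1; have k2 := ler_wM_norm nr0 bE2.
  by apply: le_trans (lerD k1 k2) _; rewrite le_eqVlt; apply/orP; left; apply/eqP; ring.
have dD : `|D - D'| * n <= b * (c0 * e).
  rewrite /c0 (_ : b * _ = b * (1 + b) ^+ 3 * e / eta ^+ 2); last by ring.
  apply: cancel; first by rewrite !mulr_ge0 ?exprn_ge0 ?(ltW b0).
  rewrite sol2 (le_trans (ler_normB _ _))//.
  have k1 := ler_wM_norm nr2 bE1; have k2 := ler_wM_norm nr1 bE2.
  by apply: le_trans (lerD k1 k2) _; rewrite le_eqVlt; apply/orP; left; apply/eqP; ring.
have c00 : 0 <= c0 * e by rewrite mulr_ge0// divr_ge0 ?(ltW eta2)// exprn_ge0.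
have dth1 : `|th.1 - th'.1| * n <= c0 * e.
  have tt : `|T - T'| = 2 * `|th.1 - th'.1|.
    by rewrite /T /T' -mulrBr normrM ger0_norm.
  have := mulr_ge0 (normr_ge0 (th.1 - th'.1)) n0.
  by move: dT; rewrite tt -mulrA; clear; lra.
have dth2 : `|th.2 - th'.2| * n <= b / eta * (c0 * e).
  (* The difference of the squared imaginary parts is D - D' minus that of the squared real parts;
     it factors through th.2 + th'.2, which is at least 2 eta. *)
  have hh : (2 * eta) * (`|th.2 - th'.2| * n) <= 2 * b * (c0 * e).
    apply: le_trans (_ : (th.2 + th'.2) * (`|th.2 - th'.2| * n) <= _).
      by rewrite ler_wpM2r ?mulr_ge0.
    have -> : (th.2 + th'.2) * (`|th.2 - th'.2| * n) =
       `|(D - D') - (th.1 + th'.1) / 2 * (T - T')| * n.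
      rewrite mulrA; congr (_ * _); rewrite -[X in X * _](ger0_norm s0) -normrM.
      by congr Num.norm; rewrite /D /D' /T /T'; field.
    apply: le_trans (ler_wpM2r n0 (ler_normB _ _)) _.
    rewrite mulrDl normrM -[X in _ + X]mulrA.
    have k := ler_pM (normr_ge0 _) (mulr_ge0 (normr_ge0 _) n0) nh dT.
    by move: dD k; clear; lra.
  rewrite mulrAC ler_pdivlMr//; by move: hh; clear; lra.
pose c1 := c0 * (1 + b / eta).
have dth : Cdist th th' * n <= c1 * e.
  apply: le_trans (ler_wpM2r n0 (Cdist_le_sum _ _)) _.
  by rewrite mulrDl; move: dth1 dth2; rewrite /c1; clear; lra.
have dthr := le_trans (ler_wpM2r n0 (Cdist_re th th')) dth.
have dthi := le_trans (ler_wpM2r n0 (Cdist_im th th')) dth.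
(* Re (theta u) = th.1 u.1 - th.2 u.2 is solved for u.2, using th'.2 > eta. *)
have du2 : `|u.2 - u'.2| <= (1 + b + 2 * c1) / eta * e.
  rewrite mulrAC ler_pdivlMr//.
  apply: le_trans (_ : `|th'.2 * (u.2 - u'.2)| <= _).
    by rewrite normrM mulrC ler_wpM2r// (gtr0_norm t0') ltW.
  have -> : th'.2 * (u.2 - u'.2) = (th.1 - th'.1) * u.1 + th'.1 * (u.1 - u'.1)
      - (r1 - r1') - (th.2 - th'.2) * u.2 by rewrite /r1 /r1' /Cmul /=; ring.
  have q1 : `|(th.1 - th'.1) * u.1| <= c1 * e.
    by rewrite normrM; apply: le_trans dthr; rewrite ler_wpM2l.
  have q2 : `|th'.1 * (u.1 - u'.1)| <= b * e.
    by apply: ler_wM_norm => //; apply: le_trans (Cnorm_re _) _.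
  have q3 : `|(th.2 - th'.2) * u.2| <= c1 * e.
    by rewrite normrM; apply: le_trans dthi; rewrite ler_wpM2l// Cnorm_im.
  apply: le_trans (ler_normB _ _) _.
  have := ler_normB ((th.1 - th'.1) * u.1 + th'.1 * (u.1 - u'.1)) (r1 - r1').
  have := ler_normD ((th.1 - th'.1) * u.1) (th'.1 * (u.1 - u'.1)).
  by move: q1 q2 q3 d1; clear; lra.
have c10 : 0 <= c1 * e.
  by apply: le_trans dth; rewrite mulr_ge0// Cdist_ge0.
rewrite /run_const -/c0 -/c1.
have w0 := le_trans (normr_ge0 _) du2.
split; last by move: dth w0 e0; clear; lra.
apply: le_trans (Cdist_le_sum _ _) _; by move: du2 d0 c10; rewrite -/r0 -/r0'; clear; lra.
Qed.

End Run.

(** * Counting parameters with few bad blocks *)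

Section Blocks.
Variables (R : realType) (N : nat) (beta : 'I_N.+1 -> cplx R).
Local Notation I := 'I_N.+1.
Implicit Types (a b eta M D delta rho : R) (s : cplx R * cplx R).
Implicit Types (om : nat -> I) (S : set (cplx R * cplx R)).
Local Notation orbit := (orbit beta).
Local Notation close := (close beta).
Local Notation admissible := (admissible beta).

Definition near_int rho (x : R) := exists k : int, `|x - k%:~R| <= rho.

Definition run_at om n := all (fun i => om (n + i)%N == ord0) (iota 0 4).

(** Only runs aligned on multiples of 4 inside the block are considered: the [l] slots are then
    disjoint, hence independent under a Bernoulli law. *)
Definition has_run l om j := has (fun i => run_at om (j * (4 * l) + 4 * i)) (iota 0 l).

Definition near_run rho om n s :=
  forall i, (i < 4)%N -> near_int rho (orbit om (n + i) s).1.

(** The condition bears on all aligned runs, so that two states for which the block is good can be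
    compared at the same run. *)
Definition good_block rho l om j s := has_run l om j /\
  forall i, (i < l)%N -> run_at om (j * (4 * l) + 4 * i) ->
    near_run rho om (j * (4 * l) + 4 * i) s.

(** The two nearby integers differ by at most 1/2 + 2/8 < 1, so they coincide: a coarse distance 1/2
    improves to 2 rho. *)
Lemma near_int_eq rho D (x y : R) : rho <= 8^-1 -> D <= 2^-1 -> `|x - y| <= D ->
  near_int rho x -> near_int rho y -> `|x - y| <= 2 * rho.
Proof.
move=> hr hD xy [k hk] [m hm].
have km : k = m.
  have : `|k%:~R - m%:~R : R| < 1.
    have -> : k%:~R - m%:~R = (x - y) - (x - k%:~R) + (y - m%:~R) :> R by ring.
    have := ler_normD ((x - y) - (x - k%:~R)) (y - m%:~R).
    have := ler_normB (x - y) (x - k%:~R).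
    lra.
  by rewrite -intrB -intr_norm ltrz1 => h; lia.
move: hm; rewrite -km => hm.
have -> : x - y = (x - k%:~R) - (y - k%:~R) by ring.
by have := ler_normB (x - k%:~R) (y - k%:~R); lra.
Qed.

Lemma run_orbit a b eta om n s i : 1 < a -> a < b -> 0 < eta -> beta ord0 = Cone R ->
  admissible a b eta s.1 -> run_at om n -> (i < 3)%N ->
  orbit om (n + i) s = Cmul s.1 (orbit om (n + i.+1) s).
Proof.
move=> a1 ab eta0 b1 [A _] run i3; rewrite orbitS -addnS; congr Cmul.
have /eqP -> : om (n + i)%N == ord0.
  by apply: (allP run); rewrite mem_iota; lia.
by rewrite /expansion b1 Cmul1z (CexpK a1 ab eta0 A).
Qed.

(** Going back from the end of the block, the distance stays at most 1/2, so at the four times of a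
    run the integers agree and the real parts differ by at most 2 rho. [run_close] converts this
    into closeness of order rho, and [hrd] leaves room for the at most 4l steps down to the start of
    the block. *)
Lemma good_block_close a b eta M B rho delta l om j s s' :
  1 < a -> a < b -> 0 < eta -> beta ord0 = Cone R ->
  (forall i, Cnorm (beta i) <= M) ->
  b + 4 * b * (M * (1 + 2 * (b / eta))) <= B -> 1 <= B ->
  0 <= delta -> B ^+ (4 * l) * delta <= 2^-1 -> rho <= 8^-1 ->
  B ^+ (4 * l) * (run_const b eta * (2 * rho)) <= delta ->
  admissible a b eta s.1 -> admissible a b eta s'.1 ->
  good_block rho l om j s -> good_block rho l om j s' ->
  close om (j.+1 * (4 * l)) delta s s' -> close om (j * (4 * l)) delta s s'.
Proof.
move=> a1 ab eta0 b1 hM hB B1 d0 hd hr hrd adm adm' [/hasP[i il run] gs] [_ gs'] cl.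
move: il; rewrite mem_iota add0n => /andP[_ il].
have ns := gs _ il run; have ns' := gs' _ il run.
set n := (j * (4 * l) + 4 * i)%N in run ns ns'.
have back k m : (k + m = j.+1 * (4 * l))%N -> (m <= 4 * l)%N -> close om k 2^-1 s s'.
  move=> km ml; move: cl; rewrite -km.
  move=> /(close_back a1 ab eta0 hM hB adm adm'); apply: close_le.
  apply: le_trans hd; rewrite ler_wpM2r//; exact: ler_weXn2l.
have nr k : (k < 4)%N -> `|(orbit om (n + k) s).1 - (orbit om (n + k) s').1| <= 2 * rho.
  move=> k4; apply: (near_int_eq hr (lexx _)) (ns _ k4) (ns' _ k4).
  have e : (n + k + (4 * l - (4 * i + k)) = j.+1 * (4 * l))%N by move: il k4; rewrite /n mulSn; clear; lia.
  have [h _] := back _ _ e (leq_subr _ _).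
  exact: le_trans (Cdist_re _ _) h.
have step t : admissible a b eta t.1 -> forall k, (k < 3)%N ->
    orbit om (n + k) t = Cmul t.1 (orbit om (n + k.+1) t).
  by move=> at1 k; exact: (run_orbit a1 ab eta0 b1 at1 run).
have [A _] := adm; have [A' _] := adm'.
have e2 t (at1 : admissible a b eta t.1) :
    orbit om (n + 2) t = Cmul t.1 (orbit om (n + 3) t) by exact: step.
have e1 t (at1 : admissible a b eta t.1) :
    orbit om (n + 1) t = Cmul t.1 (Cmul t.1 (orbit om (n + 3) t)).
  by rewrite -e2//; exact: step.
have e0 t (at1 : admissible a b eta t.1) :
    orbit om (n + 0) t = Cmul t.1 (Cmul t.1 (Cmul t.1 (orbit om (n + 3) t))).
  by rewrite -e1//; exact: step.
have [||||c1 c2] := @run_close R a b eta (2 * rho) s.1 s'.1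
    (orbit om (n + 3) s) (orbit om (n + 3) s') a1 ab eta0 A A'.
- exact: nr.
- by rewrite -!e2//; exact: nr.
- by rewrite -!e1//; exact: nr.
- by rewrite -!e0//; exact: nr.
have c3 : close om (j * (4 * l) + (4 * i + 3)) (run_const b eta * (2 * rho)) s s'.
  by rewrite addnA; split.
have := close_back a1 ab eta0 hM hB adm adm' c3; apply: close_le.
apply: le_trans hrd; rewrite ler_wpM2r//.
  by apply: le_trans c1; exact: Cdist_ge0.
by apply: ler_weXn2l => //; move: il; clear; lia.
Qed.

(** A labelling by [k] labels with pairwise close fibres. Working with labels instead of balls
    avoids choosing centres until the end of the induction. *)
Definition coverable om n D S k := exists c : cplx R * cplx R -> nat,
  (forall s, S s -> (c s < k)%N) /\
  forall s s', S s -> S s' -> c s = c s' -> close om n D s s'.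

Lemma coverableU om n D S S' k k' : coverable om n D S k ->
  coverable om n D S' k' -> coverable om n D (S `|` S') (k + k').
Proof.
move=> [c [h1 h2]] [c' [h1' h2']].
exists (fun s => if `[< S s >] then c s else (k + c' s)%N); split.
  move=> s; case: asboolP => [Ss _|nSs [//|/h1']]; last by rewrite ltn_add2l.
  by rewrite ltn_addr// h1.
move=> s s'; case: asboolP => [Ss|nSs] ss; case: asboolP => [Ss'|nSs'] ss'.
- exact: h2.
- by have := h1 _ Ss; lia.
- by have := h1 _ Ss'; lia.
- by case: ss => // Ss; case: ss' => // Ss' /addnI; exact: h2'.
Qed.

Lemma coverable_sub om n D S S' k : S `<=` S' -> coverable om n D S' k ->
  coverable om n D S k.
Proof.
move=> SS' [c [h1 h2]]; exists c; split => [s /SS'|s s' /SS' h /SS' h']; last exact: h2.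
exact: h1.
Qed.

Lemma truncn_lt1 (x y : R) : 0 <= x -> 0 <= y -> Num.truncn x = Num.truncn y ->
  `|x - y| <= 1.
Proof.
move=> x0 y0 e.
have /andP[h1 h2] := truncn_itv x0; have /andP[h3 h4] := truncn_itv y0.
move: h1 h2; rewrite e -!natr1 in h4 * => h1 h2.
by rewrite ler_norml; apply/andP; split; lra.
Qed.

Definition cell (D w x : R) := Num.truncn ((x + D) / w).

Lemma cell_close (D w x y : R) : 0 < w -> `|x| <= D -> `|y| <= D ->
  cell D w x = cell D w y -> `|x - y| <= w.
Proof.
move=> w0 /ler_normlP[x1 x2] /ler_normlP[y1 y2] /truncn_lt1 h.
have -> : x - y = ((x + D) / w - (y + D) / w) * w by field; rewrite gt_eqF.
rewrite normrM (gtr0_norm w0) -[leRHS]mul1r ler_wpM2r ?(ltW w0)// h// divr_ge0//; lra.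
Qed.

Lemma cell_lt (D w x : R) m : 0 < w -> 2 * D / w <= m%:R -> `|x| <= D ->
  (cell D w x < m.+1)%N.
Proof.
move=> w0 hm; rewrite ler_norml => /andP[x1 x2].
have h0 : 0 <= (x + D) / w by rewrite divr_ge0//; lra.
rewrite /cell ltnS truncn_le_nat -natr1.
apply: le_lt_trans (_ : 2 * D / w < _); last by apply: le_lt_trans hm _; rewrite ltrDl.
by rewrite ler_wpM2r ?invr_ge0 ?(ltW w0)//; lra.
Qed.
End Blocks.

Section Counting.
Variables (R : realType) (N : nat) (beta : 'I_N.+1 -> cplx R).
Local Notation I := 'I_N.+1.
Implicit Types (a b eta M D delta rho : R) (s : cplx R * cplx R).
Implicit Types (om : nat -> I) (S : set (cplx R * cplx R)).
Local Notation orbit := (orbit beta).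
Local Notation close := (close beta).
Local Notation admissible := (admissible beta).
Local Notation coverable := (coverable beta).

Lemma pair_code_inj m x y x' y' : (y < m)%N -> (y' < m)%N ->
  (x * m + y = x' * m + y')%N -> x = x' /\ y = y'.
Proof.
move=> ym ym' e; have m0 : (0 < m)%N by lia.
have ex : x = x'.
  have := congr1 (fun z => (z %/ m)%N) e.
  by rewrite !divnMDl// !divn_small// !addn0.
by split => //; move: e; rewrite ex; lia.
Qed.

Lemma pair_code_lt m n x y : (x < n)%N -> (y < m)%N -> (x * m + y < n * m)%N.
Proof. by move=> xn ym; nia. Qed.

(** Each class is cut into cells along four real coordinates relative to a representative: two for
    the orbit point, two for theta scaled by the modulus at the representative. [kappa] is the price
    for replacing that modulus by the one at s, which [close] uses. *)
Lemma coverable_refine om n D delta kappa S k m : 0 < delta -> 1 <= kappa ->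
  (forall s s', S s -> S s' -> close om n D s s' ->
     Cnorm (orbit om n s) <= kappa * Cnorm (orbit om n s')) ->
  4 * kappa * D / delta <= m%:R ->
  coverable om n D S k -> coverable om n delta S (k * m.+1 ^ 4).
Proof.
move=> d0 k1 hk hm [c [h1 h2]].
(* Two coordinates add up to 2 w, and the change of weight multiplies by kappa. *)
pose w := delta / (2 * kappa).
have k0 : 0 < kappa by lra.
have w0 : 0 < w by rewrite divr_gt0// mulr_gt0.
have hm' : 2 * D / w <= m%:R.
  rewrite (_ : 2 * D / w = 4 * kappa * D / delta)// /w; field.
  by rewrite !gt_eqF.
pose base i := xget (0, 0) [set s | S s /\ c s = i].
have baseP s : S s -> S (base (c s)) /\ c (base (c s)) = c s.
  move=> Ss; rewrite /base.
  by have := @xgetPex _ (0, 0) [set t | S t /\ c t = c s] (ex_intro _ s (conj Ss erefl)).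
pose t1 s := (orbit om n s).1 - (orbit om n (base (c s))).1.
pose t2 s := (orbit om n s).2 - (orbit om n (base (c s))).2.
pose t3 s := (s.1.1 - (base (c s)).1.1) * Cnorm (orbit om n (base (c s))).
pose t4 s := (s.1.2 - (base (c s)).1.2) * Cnorm (orbit om n (base (c s))).
have tD s : S s -> [/\ `|t1 s| <= D, `|t2 s| <= D, `|t3 s| <= D & `|t4 s| <= D].
  move=> Ss; have [Sb cb] := baseP s Ss.
  have [p1 p2] := h2 _ _ Sb Ss cb.
  have n0 := Cnorm_ge0 (orbit om n (base (c s))).
  split.
  - by rewrite distrC; apply: le_trans (Cdist_re _ _) p1.
  - by rewrite distrC; apply: le_trans (Cdist_im _ _) p1.
  - rewrite normrM (ger0_norm n0) distrC; apply: le_trans p2.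
    by rewrite ler_wpM2r// Cdist_re.
  - rewrite normrM (ger0_norm n0) distrC; apply: le_trans p2.
    by rewrite ler_wpM2r// Cdist_im.
exists (fun s => (((c s * m.+1 + cell D w (t1 s)) * m.+1 + cell D w (t2 s)) * m.+1
   + cell D w (t3 s)) * m.+1 + cell D w (t4 s))%N; split.
  move=> s Ss; have [q1 q2 q3 q4] := tD s Ss.
  rewrite !expnSr expn0 mul1n !mulnA.
  by do !(apply: pair_code_lt; last exact: cell_lt); exact: h1.
move=> s s' Ss Ss'.
have [q1 q2 q3 q4] := tD s Ss; have [q1' q2' q3' q4'] := tD s' Ss'.
have cl x : `|x| <= D -> (cell D w x < m.+1)%N by exact: cell_lt.
move=> /(pair_code_inj (cl _ q4) (cl _ q4'))[+ e4].
move=> /(pair_code_inj (cl _ q3) (cl _ q3'))[+ e3].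
move=> /(pair_code_inj (cl _ q2) (cl _ q2'))[+ e2].
move=> /(pair_code_inj (cl _ q1) (cl _ q1'))[ec e1].
have b1 := cell_close w0 q1 q1' e1; have b2 := cell_close w0 q2 q2' e2.
have b3 := cell_close w0 q3 q3' e3; have b4 := cell_close w0 q4 q4' e4.
have [Sb cb] := baseP s Ss.
have wd : 2 * kappa * w = delta by rewrite /w; field; rewrite gt_eqF.
split.
  apply: le_trans (Cdist_le_sum _ _) _.
  move: b1 b2; rewrite /t1 /t2 -ec.
  rewrite (_ : forall x y z : R, x - y - (z - y) = x - z); last by move=> *; ring.
  rewrite (_ : forall x y z : R, x - y - (z - y) = x - z); last by move=> *; ring.
  have : 2 * w <= delta by rewrite -wd ler_wpM2r ?(ltW w0)//; lra.
  lra.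
have hn := hk _ _ Ss Sb (h2 _ _ Ss Sb (esym cb)).
move: b3 b4; rewrite /t3 /t4 -ec; set nb := Cnorm _.
have nb0 : 0 <= nb by exact: Cnorm_ge0.
rewrite -!mulrBl !normrM (ger0_norm nb0).
rewrite (_ : forall x y z : R, x - y - (z - y) = x - z); last by move=> *; ring.
rewrite (_ : forall x y z : R, x - y - (z - y) = x - z); last by move=> *; ring.
move=> b3 b4.
apply: le_trans (ler_wpM2l (Cdist_ge0 _ _) hn) _.
rewrite -wd mulrCA [leRHS](_ : _ = kappa * (2 * w)); last by ring.
rewrite ler_wpM2l ?(ltW k0)//.
apply: le_trans (ler_wpM2r nb0 (Cdist_le_sum _ _)) _; rewrite mulrDl; lra.
Qed.

Definition bad_count rho l om s j J :=
  (\sum_(j <= i < J) (~~ `[< good_block beta rho l om i s >])%R : nat)%N.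

(** The frequency is a free coordinate; only its size after [J] blocks is normalised, which is where
    the backward induction starts. *)
Definition level a b eta rho l om J m j := [set s | [/\ admissible a b eta s.1,
  1 <= Cnorm (orbit om (J * (4 * l)) s) <= b ^+ (4 * l) &
  (bad_count rho l om s j J <= m)%N]].

Section Level.
Variables (a b eta M rho delta : R) (B l A : nat).
Hypotheses (a1 : 1 < a) (ab : a < b) (eta0 : 0 < eta) (b1 : beta ord0 = Cone R)
  (hM : forall i, Cnorm (beta i) <= M)
  (hB : b + 4 * b * (M * (1 + 2 * (b / eta))) <= B%:R) (B1 : (0 < B)%N)
  (d0 : 0 < delta) (hd : B%:R ^+ (4 * l) * delta <= 2^-1) (hr : rho <= 8^-1)
  (hrd : B%:R ^+ (4 * l) * (run_const b eta * (2 * rho)) <= delta)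
  (A0 : (0 < A)%N).

Let K := ((8 * B ^ (4 * l)).+1 ^ 4)%N.
Local Notation level := (level a b eta rho l).

(** At time J the orbit point lies in a fixed bounded region and theta in the annulus, so one class
    with a large tolerance is refined to [delta]. The count depends neither on omega nor on J. *)
Lemma level_init : exists N0, (0 < N0)%N /\ forall om J m,
  coverable om (J * (4 * l)) delta (level om J m J) N0.
Proof.
pose W := b ^+ (4 * l).
have b0 : 1 <= b by move: a1 ab; lra.
have W1 : 1 <= W by rewrite exprn_ege1.
have W0 : 0 <= W by lra.
pose m0 := (Num.truncn (4 * W * (2 * b * W) / delta)).+1.
exists (m0.+1 ^ 4)%N; split; first by rewrite expn_gt0.
move=> om J m; rewrite -[(m0.+1 ^ 4)%N]mul1n.
apply: (@coverable_refine _ _ (2 * b * W) _ W) => //.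
- move=> s s' [_ /andP[_ h1] _] [_ /andP[h2 _] _] _.
  by apply: le_trans h1 _; rewrite -/W ler_peMr.
- exact: ltW (truncnS_gt _).
exists (fun=> 0%N); split => // s s' [[A1 _] /andP[_ h1] _] [[A1' _] /andP[_ h2] _] _.
have [_ u1 _] := annulus_bounds A1; have [_ u2 _] := annulus_bounds A1'.
have dist0 (z w : cplx R) : Cdist z w <= Cnorm z + Cnorm w.
  rewrite /Cdist; apply: le_trans (Cnorm_add z (- w.1, - w.2)) _.
  by rewrite lerD2l /Cnorm /= !sqrrN.
split.
  apply: le_trans (dist0 _ _) _.
  have : W <= b * W by rewrite ler_peMl.
  by move: h1 h2; rewrite -/W; lra.
have dd : Cdist s.1 s'.1 <= 2 * b by have := dist0 s.1 s'.1; lra.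
by rewrite ler_pM ?Cdist_ge0 ?Cnorm_ge0.
Qed.

(** Let N(d, m) count the cells after d backward blocks. A good block keeps them and a bad one
    multiplies by [K], so N(d+1, m) <= N(d, m) + K N(d, m-1). The bound (KA)^m (1 + 1/A)^d solves
    this recursion and replaces binomial estimates for the positions of the bad blocks. *)
Lemma level_cover N0 om J : (forall m, coverable om (J * (4 * l)) delta (level om J m J) N0) ->
  forall d m, (d <= J)%N -> exists k,
    k%:R <= N0%:R * (K * A)%:R ^+ m * (1 + A%:R^-1) ^+ d :> R /\
    coverable om ((J - d) * (4 * l)) delta (level om J m (J - d)) k.
Proof.
move=> h0; elim=> [|d ih] m dJ.
  by exists N0; rewrite subn0; split => //; rewrite expr0 mulr1 ler_peMr// exprn_ege1// ler1n muln_gt0 A0 expn_gt0.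
have dJ' : (d <= J)%N by exact: ltnW.
set j := (J - d.+1)%N; have ej : (J - d = j.+1)%N by rewrite /j -subSn.
have jJ : (j < J)%N by rewrite -ej leq_subr.
move: ih; rewrite ej => ih.
have Bge1 : 1 <= B%:R :> R by rewrite ler1n.
have good : forall k, coverable om (j.+1 * (4 * l)) delta (level om J m j.+1) k ->
   coverable om (j * (4 * l)) delta
     [set s | good_block beta rho l om j s /\ level om J m j.+1 s] k.
  move=> k [c [c1 c2]]; exists c; split => [s [_]|s s' [g L] [g' L'] e]; first exact: c1.
  have [adm _ _] := L; have [adm' _ _] := L'.
  have := c2 _ _ L L' e.
  exact: (good_block_close a1 ab eta0 b1 hM hB Bge1 (ltW d0) hd hr hrd adm adm' g g').
have bad : forall m' k, coverable om (j.+1 * (4 * l)) delta (level om J m' j.+1) k ->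
   coverable om (j * (4 * l)) delta (level om J m' j.+1) (k * K).
  move=> m' k [c [c1 c2]].
  (* Both moduli are at least 1 and differ by at most 1/2, hence kappa = 2; then 4 kappa D / delta
     is 8 B^(4l), which explains [K]. *)
  apply: (@coverable_refine _ _ (B%:R ^+ (4 * l) * delta) _ 2) => //.
  - by lra.
  - move=> s s' [adm /andP[L _] _] [adm' /andP[L' _] _] [cl _].
    have ge1 t : admissible a b eta t.1 -> 1 <= Cnorm (orbit om (J * (4 * l)) t) ->
        1 <= Cnorm (orbit om (j * (4 * l)) t).
      move=> at1 ht.
      have a0 : 0 < a by move: a1; lra.
      have /andP[+ _] := orbit_growth om (j * (4 * l)) ((J - j) * (4 * l)) a0 at1.
      rewrite -mulnDl subnKC ?(ltnW jJ)//; apply: le_trans.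
      by rewrite -[1]mulr1 ler_pM// exprn_ege1// ltW.
    have := Cnorm_le_dist (orbit om (j * (4 * l)) s) (orbit om (j * (4 * l)) s').
    have := ge1 _ adm' L'; move: cl hd; lra.
  - rewrite le_eqVlt; apply/orP; left; apply/eqP.
    by rewrite natrM natrX; field; rewrite gt_eqF.
  exists c; split => [//|s s' L L' e].
  have [adm _ _] := L; have [adm' _ _] := L'.
  have := c2 _ _ L L' e; rewrite mulSn addnC.
  exact: (close_back a1 ab eta0 hM hB adm adm').
have Z0 : 0 < (K * A)%:R :> R by rewrite ltr0n muln_gt0 A0 expn_gt0.
have An0 : A%:R != 0 :> R by rewrite pnatr_eq0 -lt0n.
have A1 : 0 <= 1 + A%:R^-1 :> R by rewrite addr_ge0// invr_ge0.
have cnt s : bad_count rho l om s j J =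
    (~~ `[< good_block beta rho l om j s >] + bad_count rho l om s j.+1 J)%N.
  by rewrite /bad_count big_ltn.
have [k [hk ck]] := ih m dJ'.
case: m => [|m] in hk ck good *.
  exists k; split.
    apply: le_trans hk _; rewrite [in leRHS]exprSr [leRHS]mulrA ler_peMr//; last by rewrite lerDl invr_ge0.
  apply: coverable_sub (good _ ck) => s [p1 p2]; rewrite cnt leqn0 addn_eq0 eqb0 negbK.
  by move=> /andP[/asboolP g /eqP c]; split => //; split => //; rewrite c.
have [k' [hk' ck']] := ih m dJ'.
exists (k + k' * K)%N; split.
  rewrite natrD natrM.
  have K0 : 0 <= K%:R :> R by [].
  apply: le_trans (lerD hk (ler_wpM2r K0 hk')) _.
  rewrite le_eqVlt; apply/orP; left; apply/eqP.
  rewrite !exprSr natrM.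
  move: (_ ^+ m) (_ ^+ d) => x y; move: (K%:R : R) (N0%:R : R) => z n; field.
  by rewrite An0.
apply: coverable_sub (coverableU (good _ ck) (bad _ _ ck')) => s [p1 p2]; rewrite cnt.
case: asboolP => /= g c; [left|right]; first by split => //; split.
by split => //; rewrite -ltnS.
Qed.

End Level.

(** At time 0 the second clause of [close] reads |theta - theta'| |x| <= delta, and |x| >= a^(J *
    4l) because the orbit still has modulus at least 1 after J blocks. The parameter of one
    representative per label serves as centre. *)
Lemma bad_parameters_cover a b eta M rho delta (B l A : nat) :
  1 < a -> a < b -> 0 < eta -> beta ord0 = Cone R ->
  (forall i, Cnorm (beta i) <= M) ->
  b + 4 * b * (M * (1 + 2 * (b / eta))) <= B%:R -> (0 < B)%N ->
  0 < delta -> B%:R ^+ (4 * l) * delta <= 2^-1 -> rho <= 8^-1 ->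
  B%:R ^+ (4 * l) * (run_const b eta * (2 * rho)) <= delta -> (0 < A)%N ->
  exists N0 : nat, forall om J m, exists (k : nat) (ctr : nat -> cplx R),
    k%:R <= N0%:R * ((8 * B ^ (4 * l)).+1 ^ 4 * A)%:R ^+ m * (1 + A%:R^-1) ^+ J :> R /\
    forall th x, level a b eta rho l om J m 0 (th, x) ->
      exists2 i, (i < k)%N & Cdist (ctr i) th <= delta / a ^+ (J * (4 * l)).
Proof.
move=> a1 ab eta0 b1 hM hB B1 d0 hd hr hrd A0.
have [N0 [_ h0]] := level_init eta rho l a1 ab d0.
exists N0 => om J m.
have [k [hk]] := level_cover a1 ab eta0 b1 hM hB B1 d0 hd hr hrd A0 (h0 om J) m (leqnn J).
rewrite subnn mul0n => -[c [c1 c2]].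
pose ctr i := (xget (0, 0) [set s | level a b eta rho l om J m 0 s /\ c s = i]).1.
exists k, ctr; split => // th x L.
exists (c (th, x)); first exact: c1.
rewrite /ctr; have := @xgetPex _ (0, 0) [set s | level a b eta rho l om J m 0 s /\ c s = c (th, x)]
  (ex_intro _ (th, x) (conj L erefl)).
set s := xget _ _ => -[Ls cs].
have [_] := c2 _ _ Ls L cs; rewrite /= => h.
have a0 : 0 < a by lra.
rewrite ler_pdivlMr ?exprn_gt0//; apply: le_trans h.
rewrite ler_wpM2l ?Cdist_ge0//.
have [adm /andP[L1 _] _] := Ls.
have /andP[+ _] := orbit_growth om 0 (J * (4 * l)) a0 adm.
by rewrite add0n; apply: le_trans; rewrite ler_peMr// exprn_ge0// ltW.
Qed.

End Counting.

(** * Product laws on sequence spaces *)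

Section SequenceSpace.
Variables (R : realType) (T : pointedType) (code : T -> nat).
Hypothesis code_inj : injective code.
Local Notation U := (g_sigma_algebraType (@cyl T)).
Implicit Types (v w : seq T) (F : seq T -> R).

Definition cylinder v : set U := [set u : U | mkseq u (size v) = v].

Lemma cylinderE v : cylinder v =
  [set u : U | forall m, (m < size v)%N -> u m = nth point v m].
Proof.
apply/seteqP; split => u /=; rewrite /cylinder /= => h.
  by move=> m mv; rewrite -{1}h nth_mkseq.
apply: (@eq_from_nth _ point); rewrite size_mkseq// => i iv.
by rewrite nth_mkseq// h.
Qed.

Lemma measurable_cylinder v : measurable (cylinder v).
Proof.
rewrite cylinderE; apply: sub_gen_smallest => /=.
by exists (size v), (nth point v).
Qed.

(** A countable alphabet has countably many words, so any condition on a prefix is a countable union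
    of cylinders. *)
Lemma measurable_prefix n (A : set (seq T)) :
  measurable [set u : U | A (mkseq u n)].
Proof.
pose c v := CodeSeq.code (map code v).
have c_inj : injective c.
  by move=> v w /(can_inj CodeSeq.codeK); apply: inj_map.
have -> : [set u : U | A (mkseq u n)] =
    \bigcup_k [set u : U | A (mkseq u n) /\ c (mkseq u n) = k].
  apply/seteqP; split => u /=; last by case=> k _ [].
  by move=> h; exists (c (mkseq u n)).
apply: bigcupT_measurable => k.
case: (pselect (exists u : U, A (mkseq u n) /\ c (mkseq u n) = k)) => [[u0 [A0 c0]]|h].
  rewrite (_ : mkset _ = cylinder (mkseq u0 n)); first exact: measurable_cylinder.
  apply/seteqP; split => u; rewrite /cylinder /= size_mkseq.
    by case=> _; rewrite -c0 => /c_inj.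
  by move=> ->.
rewrite (_ : mkset _ = set0) // -subset0 => u hu; apply: h; by exists u.
Qed.

Lemma measurable_prefix_fun n F : measurable_fun setT (fun u : U => F (mkseq u n)).
Proof.
move=> _ Y mY; rewrite setTI.
exact: (measurable_prefix n [set v | Y (F v)]).
Qed.

Variables (mu : probability U R) (supp : nat -> seq T) (wt : nat -> T -> R).

Definition weight v := \prod_(m < size v) wt m (nth point v m).

Hypotheses (supp_uniq : forall n, uniq (supp n))
  (wt_sum : forall n, \sum_(x <- supp n) wt n x = 1)
  (mu_cyl : forall v, mu (cylinder v) = (weight v)%:E).

(** Expectation over a word of independent letters, as an iterated finite sum; [k] is the time of
    the first letter. *)
Fixpoint expect (k n : nat) F : R :=
  if n is n'.+1 then \sum_(x <- supp k) wt k x * expect k.+1 n' (fun w => F (x :: w))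
  else F [::].

Lemma weight_rcons v x : weight (rcons v x) = weight v * wt (size v) x.
Proof.
rewrite /weight size_rcons big_ord_recr /= nth_rcons ltnn eqxx; congr (_ * _).
by apply: eq_bigr => i _; rewrite nth_rcons ltn_ord.
Qed.

Lemma prefix_integrable (D : set U) n F (C : R) : measurable D ->
  (forall v, `|F v| <= C) -> mu.-integrable D (EFin \o (fun u : U => F (mkseq u n))).
Proof.
move=> mD FC; apply: measurable_bounded_integrable => //.
- by apply: le_lt_trans (probability_le1 mu mD) _; rewrite ltry.
- by apply: measurable_funTS; exact: measurable_prefix_fun.
- exists C; split; first exact: num_real.
  by move=> M CM u _ /=; apply: le_trans (FC _) (ltW CM).
Qed.

Let ext v (s : seq T) : set U := [set u : U | cylinder v u /\ u (size v) \in s].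

Let ext_measurable v s : measurable (ext v s).
Proof.
rewrite (_ : ext v s = [set u : U |
  [set w | take (size v) w = v /\ nth point w (size v) \in s] (mkseq u (size v).+1)]).
  exact: measurable_prefix.
apply/seteqP; split => u; rewrite /ext /cylinder /= nth_mkseq// /mkseq -map_take.
  by rewrite take_iota (minn_idPl _).
by rewrite take_iota (minn_idPl _).
Qed.

Lemma cylinder_rcons v x : cylinder (rcons v x) = [set u : U | cylinder v u /\ u (size v) = x].
Proof.
apply/seteqP; split => u; rewrite /cylinder /= size_rcons /mkseq -addn1 iotaD map_cat /= add0n cats1.
  by move=> /rcons_inj[-> ->].
by move=> [-> ->].
Qed.

Let Rintegral_ext v s n F (C : R) : (forall v, `|F v| <= C) -> uniq s ->
  \int[mu]_(u in ext v s) F (mkseq u n)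
    = \sum_(x <- s) \int[mu]_(u in cylinder (rcons v x)) F (mkseq u n).
Proof.
move=> FC; elim: s => [_|x s ih /= /andP[xs us]].
  rewrite big_nil (_ : ext v [::] = set0) ?Rintegral_set0//.
  by rewrite -subset0 => u [].
rewrite big_cons -ih// (_ : ext v (x :: s) = cylinder (rcons v x) `|` ext v s).
  apply: Rintegral_setU.
  - exact: measurable_cylinder.
  - exact: ext_measurable.
  - apply: prefix_integrable FC; apply: measurableU; first exact: measurable_cylinder.
    exact: ext_measurable.
  - apply/disj_setPS => u [] /=; rewrite cylinder_rcons => -[_ ux] [_].
    by rewrite ux (negPf xs).
rewrite cylinder_rcons; apply/seteqP; split => u; rewrite /ext /= inE.
  by move=> [cu /orP[/eqP|]]; [left|right].
by move=> [[cu ->]|[cu h]]; rewrite ?eqxx ?h ?orbT.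
Qed.

(** The extensions of v by letters of [supp] already carry the whole mass of the cylinder, since
    [wt] sums to 1 there. What remains is null, so an infinite alphabet still gives finite sums. *)
Lemma integral_cylinder n v F (C : R) : (forall w, `|F w| <= C) ->
  \int[mu]_(u in cylinder v) F (mkseq u (size v + n))
    = weight v * expect (size v) n (fun w => F (v ++ w)).
Proof.
move=> FC; elim: n v => [|n ih] v.
  rewrite /= cats0 addn0.
  under eq_Rintegral => u.
    rewrite inE => /= hu; rewrite {1}hu; over.
  rewrite (Rintegral_cst _ (measurable_cylinder v)) mulrC; congr (_ * _).
  by rewrite -[RHS]/(fine (weight v)%:E) -mu_cyl.
have mc := measurable_cylinder v.
have me := ext_measurable v (supp (size v)).
have sub : ext v (supp (size v)) `<=` cylinder v by move=> u [].
have null : mu (cylinder v `\` ext v (supp (size v))) = 0%E.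
  have fin A : measurable A -> mu A \is a fin_num.
    by move=> mA; rewrite ge0_fin_numE// (le_lt_trans (probability_le1 mu mA))// ltry.
  rewrite measureD//; last first.
    by apply: le_lt_trans (probability_le1 mu mc) _; rewrite ltry.
  rewrite setIidr//.
  have ext1 : mu (ext v (supp (size v))) = (weight v)%:E.
    rewrite -(fineK (fin _ me)); congr EFin.
    have := @Rintegral_ext v (supp (size v)) 0 (fun=> 1) 1 _ (supp_uniq _).
    rewrite Rintegral_cst// mul1r => ->; last by move=> _; rewrite normr1.
    under eq_bigr => x _.
      rewrite (Rintegral_cst _ (measurable_cylinder _)) mul1r.
      rewrite (_ : fine _ = weight v * wt (size v) x); last first.
        by rewrite -weight_rcons -[RHS]/(fine (weight _)%:E) -mu_cyl.
      over.
    by rewrite -big_distrr /= wt_sum mulr1.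
  transitivity ((weight v)%:E - (weight v)%:E)%E; last by rewrite subee.
  by congr (_ - _)%E; [exact: mu_cyl|exact: ext1].
transitivity (\int[mu]_(u in ext v (supp (size v))) F (mkseq u (size v + n.+1))).
  rewrite /Rintegral (negligible_integral _ _ _ null)//.
  - by rewrite setDD setIidr.
  - exact: measurableD.
  - exact: prefix_integrable FC.
rewrite (Rintegral_ext _ _ FC)// /= big_distrr /=; apply: eq_bigr => x _.
have := ih (rcons v x); rewrite size_rcons addSnnS weight_rcons => ->.
rewrite mulrA; congr (_ * _).
by congr expect; apply/funext => w; rewrite cat_rcons.
Qed.

Lemma integral_prefix n F (C : R) : (forall w, `|F w| <= C) ->
  \int[mu]_u F (mkseq u n) = expect 0 n F.
Proof.
move=> FC; have := @integral_cylinder n [::] F C FC.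
rewrite (_ : cylinder [::] = setT) ?add0n => [->|]; last by apply/seteqP; split.
by rewrite /weight big_ord0 mul1r.
Qed.

Lemma measure_prefix n (A : set (seq T)) :
  mu [set u : U | A (mkseq u n)] = (expect 0 n (fun w => (`[< A w >] : nat)%:R))%:E.
Proof.
rewrite -(@integral_prefix n _ 1); last by move=> w; case: asboolP; rewrite /= ?normr1 ?normr0.
have mA := measurable_prefix n A.
have fin : mu [set u : U | A (mkseq u n)] \is a fin_num.
  by rewrite ge0_fin_numE// (le_lt_trans (probability_le1 mu mA))// ltry.
rewrite -(fineK fin); congr EFin.
rewrite -[LHS]mul1r -Rintegral_cst// Rintegral_mkcond.
apply: eq_Rintegral => u _; rewrite patchE /=.
by case: asboolP => h /=; [rewrite mem_set|rewrite memNset].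
Qed.

End SequenceSpace.

(** * Blocks without a run are rare *)

Section Expectation.
Variables (R : realType) (T : pointedType) (s : seq T) (q : T -> R).
Implicit Types F G : seq T -> R.
Local Notation E := (expect (fun=> s) (fun=> q)).

Lemma expect_shift k n F : E k n F = E 0 n F.
Proof.
elim: n k F => [//|n ih] k F /=; apply: eq_bigr => x _.
by rewrite ih (ih 1%N).
Qed.

Lemma expectS n F : E 0 n.+1 F = \sum_(x <- s) q x * E 0 n (fun w => F (x :: w)).
Proof. by rewrite /=; apply: eq_bigr => x _; rewrite expect_shift. Qed.

Lemma expectZ n c F : E 0 n (fun w => c * F w) = c * E 0 n F.
Proof.
elim: n F => [//|n ih] F; rewrite !expectS big_distrr /=; apply: eq_bigr => x _.
by rewrite ih mulrCA.
Qed.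

Lemma expectD n F G : E 0 n (fun w => F w + G w) = E 0 n F + E 0 n G.
Proof.
elim: n F G => [//|n ih] F G; rewrite !expectS -big_split /=; apply: eq_bigr => x _.
by rewrite ih mulrDr.
Qed.

Lemma expect_split m n F G :
  E 0 (m + n) (fun w => F (take m w) * G (drop m w)) = E 0 m F * E 0 n G.
Proof.
elim: m F => [|m ih] F.
  rewrite add0n /= -expectZ; congr expect; apply/funext => w.
  by rewrite take0 drop0.
rewrite addSn !expectS big_distrl /=; apply: eq_bigr => x _.
by rewrite -mulrA -ih.
Qed.

Definition block L j (w : seq T) := take L (drop (j * L) w).

(** Independence and stationarity: disjoint blocks of equal length contribute equal factors. *)
Lemma expect_blocks J L F :
  E 0 (J * L) (fun w => \prod_(j < J) F (block L j w)) = E 0 L F ^+ J.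
Proof.
elim: J => [|J ih]; first by rewrite /= big_ord0 expr0.
rewrite exprS -ih -expect_split mulSn; congr expect; apply/funext => w.
rewrite big_ord_recl /block mul0n drop0; congr (_ * _); apply: eq_bigr => i _.
by rewrite drop_drop mulSn addnC.
Qed.

Hypotheses (q0 : forall x, 0 <= q x) (q1 : \sum_(x <- s) q x = 1).

Lemma le_expect n F G : (forall w, F w <= G w) -> E 0 n F <= E 0 n G.
Proof.
elim: n F G => [|n ih] F G FG; first exact: FG.
rewrite !expectS; apply: ler_sum => x _; by rewrite ler_wpM2l// ih.
Qed.

Lemma expect_cst n c : E 0 n (fun=> c) = c.
Proof. by elim: n => [//|n ih]; rewrite expectS ih -big_distrl /= q1 mul1r. Qed.

End Expectation.

Lemma take_drop_mkseq (T : Type) (f : nat -> T) m k n : (k + m <= n)%N ->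
  take m (drop k (mkseq f n)) = mkseq (fun i => f (k + i)%N) m.
Proof.
move=> kmn; rewrite /mkseq -map_drop -map_take drop_iota take_iota add0n.
rewrite (minn_idPl _); last by lia.
by rewrite -[k in LHS]addn0 iotaDl -map_comp.
Qed.

Section FewBadBlocks.
Variables (R : realType) (N : nat) (q : 'I_N.+1 -> R) (P : probability (OmegaT N) R).
Local Notation I := 'I_N.+1.
Hypotheses (q0 : forall i, 0 < q i) (q1 : \sum_i q i = 1) (HP : bernoulli_law q P).
Local Notation E := (expect (fun=> enum I) (fun=> q) 0).

Lemma Omega_measure n (A : set (seq I)) :
  P [set om : OmegaT N | A (mkseq om n)] = (E n (fun w => (`[< A w >] : nat)%:R))%:E.
Proof.
apply: (@measure_prefix R I (@nat_of_ord _) _ P) => //.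
- exact: ord_inj.
- by move=> _; exact: enum_uniq.
- by move=> _; rewrite big_enum.
- by move=> v; rewrite cylinderE; exact: HP.
Qed.

Definition zero_word (v : seq I) := all (pred1 ord0) v.

Definition runless l (v : seq I) := ~~ has (fun i => zero_word (block 4 i v)) (iota 0 l).

Lemma run_at_block l (om : nat -> I) J j i : (j < J)%N -> (i < l)%N ->
  run_at om (j * (4 * l) + 4 * i)
    = zero_word (block 4 i (block (4 * l) j (mkseq om (J * (4 * l))))).
Proof.
move=> jJ il; rewrite /block take_drop_mkseq; last by nia.
rewrite take_drop_mkseq; last by lia.
rewrite /run_at /zero_word /mkseq all_map; apply: eq_all => k /=.
by rewrite (mulnC i) addnA.
Qed.

Lemma has_run_block l (om : nat -> I) J j : (j < J)%N ->
  has_run l om j = ~~ runless l (block (4 * l) j (mkseq om (J * (4 * l)))).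
Proof.
move=> jJ; rewrite /runless negbK /has_run; apply: eq_in_has => i.
by rewrite mem_iota add0n => /andP[_ il]; exact: run_at_block.
Qed.

Lemma expect_zero_word n : E n (fun w => (zero_word w : nat)%:R) = q ord0 ^+ n.
Proof.
elim: n => [|n ih]; first by rewrite /= expr0.
rewrite expectS big_enum /= (bigD1 ord0)//= ih exprS big1 ?addr0// => i i0.
have -> : (fun w => (zero_word (i :: w) : nat)%:R) = (fun=> 0 : R).
  by apply/funext => w; rewrite /zero_word /= (negPf i0).
by rewrite expect_cst ?mulr0// big_enum.
Qed.

Lemma prod_bool (p : pred nat) l :
  \prod_(j < l) (p j : nat)%:R = (all p (iota 0 l) : nat)%:R :> R.
Proof.
elim: l => [|l ih]; first by rewrite big_ord0.
by rewrite big_ord_recr ih -[in RHS]addn1 iotaD all_cat /= andbT -natrM mulnb.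
Qed.

Lemma expect_runless l : E (4 * l) (fun w => (runless l w : nat)%:R) = (1 - q ord0 ^+ 4) ^+ l.
Proof.
have ->: 1 - q ord0 ^+ 4 = E 4 (fun w => 1 + -1 * (zero_word w : nat)%:R).
  rewrite expectD expectZ expect_zero_word mulN1r; congr (_ - _).
  by rewrite expect_cst// big_enum.
rewrite -expect_blocks mulnC; congr expect; apply/funext => w.
rewrite /runless -all_predC -prod_bool; apply: eq_bigr => j _ /=.
by case: zero_word; rewrite /= ?mulr1 ?mulr0 ?addr0 ?subrr.
Qed.

Definition runless_count l (om : nat -> I) J := (\sum_(j < J) ~~ has_run l om j)%N.

Definition many_runless (e l J : nat) : set (OmegaT N) :=
  [set om : OmegaT N | (J < e * runless_count l om J)%N].

Let word_count l J w := (\sum_(j < J) runless l (block (4 * l) j w))%N.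

Let many_runlessE e l J : many_runless e l J = [set om : OmegaT N |
  [set w | (J < e * word_count l J w)%N] (mkseq om (J * (4 * l)))].
Proof.
apply/seteqP; split => om; rewrite /many_runless /runless_count /word_count /=.
  by under eq_bigr => j _ do rewrite (has_run_block _ _ (ltn_ord j)) negbK.
by under [in X in _ -> X]eq_bigr => j _ do rewrite (has_run_block _ _ (ltn_ord j)) negbK.
Qed.

Lemma measurable_many_runless e l J : measurable (many_runless e l J).
Proof.
rewrite many_runlessE; apply: (measurable_prefix (code := @nat_of_ord _)).
exact: ord_inj.
Qed.

(* Chernoff bound: E[4^(e * count)] is the J-th power of a number at most 2. *)
Lemma measure_many_runless e l J : (1 - q ord0 ^+ 4) ^+ l <= (4 ^+ e)^-1 ->
  (P (many_runless e l J) <= (2^-1 ^+ J)%:E)%E.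
Proof.
move=> small; rewrite many_runlessE Omega_measure lee_fin.
have q0' i : 0 <= q i by exact: ltW.
pose h w : R := (4 ^+ e) ^+ runless l w.
apply: le_trans (_ : E (J * (4 * l)) (fun w => (4 ^+ J)^-1 *
    \prod_(j < J) h (block (4 * l) j w)) <= _).
  apply: le_expect => // w.
  have -> : \prod_(j < J) h (block (4 * l) j w) = 4 ^+ (e * word_count l J w).
    by rewrite /h exprM /word_count -prodrXr.
  case: asboolP => /= [H|_]; last by rewrite mulr_ge0 ?invr_ge0 ?exprn_ge0.
  rewrite mulrC ler_pdivlMr ?exprn_gt0// mul1r.
  by apply: ler_weXn2l; [rewrite ler1n|exact: ltnW].
rewrite expectZ expect_blocks.
have h2 : E (4 * l) h <= 2.
  apply: le_trans (_ : E (4 * l) (fun w => 1 + 4 ^+ e * (runless l w : nat)%:R) <= _).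
    apply: le_expect => // w; rewrite /h; case: runless => /=.
      by rewrite expr1 mulr1 lerDr.
    by rewrite expr0 mulr0 addr0.
  rewrite expectD expectZ expect_runless expect_cst ?big_enum//.
  have : 4 ^+ e * (1 - q ord0 ^+ 4) ^+ l <= 1 :> R.
    by rewrite mulrC -ler_pdivlMr ?exprn_gt0// mul1r.
  lra.
have h0 : 0 <= E (4 * l) h.
  rewrite -[leLHS](expect_cst (s := enum I) (q := q) _ (4 * l) 0) ?big_enum//.
  by apply: le_expect => // w; rewrite exprn_ge0 ?exprn_ge0.
apply: le_trans (_ : (4 ^+ J)^-1 * 2 ^+ J <= _).
  rewrite ler_wpM2l ?invr_ge0 ?exprn_ge0//.
  by apply: lerXn2r; rewrite ?nnegrE.
rewrite -exprVn -exprMn le_eqVlt; apply/orP; left; apply/eqP.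
by congr (_ ^+ _); field.
Qed.

Lemma exists_block_length e : exists2 l, (0 < l)%N & (1 - q ord0 ^+ 4) ^+ l <= (4 ^+ e)^-1.
Proof.
have q4 : 0 < q ord0 ^+ 4 by rewrite exprn_gt0.
have qle : q ord0 ^+ 4 <= 1.
  rewrite exprn_ile1 ?(ltW (q0 _))// -q1 (bigD1 ord0)//= lerDl.
  by apply: sumr_ge0 => i _; exact: ltW.
have [x0 x1] : 0 <= 1 - q ord0 ^+ 4 /\ 1 - q ord0 ^+ 4 < 1 by split; lra.
have : (1 - q ord0 ^+ 4) ^+ n @[n --> \oo] --> (0 : R).
  by apply: cvg_expr; rewrite ger0_norm.
have e0 : 0 < (4 ^+ e)^-1 :> R by rewrite invr_gt0 exprn_gt0.
move=> /cvgrPdist_le/(_ _ e0)[n _ hn].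
exists n.+1 => //; have /= := hn n.+1 (leqnSn n).
by rewrite sub0r normrN ger0_norm// exprn_ge0.
Qed.

(** Borel-Cantelli with the summable bounds 2^-J. *)
Lemma few_runless e l : (1 - q ord0 ^+ 4) ^+ l <= (4 ^+ e)^-1 ->
  P (lim_sup_set (many_runless e l)) = 0%E.
Proof.
move=> small; apply: lim_sup_set_cvg0 => [J|]; first exact: measurable_many_runless.
apply: (@le_lt_trans _ _ (\sum_(J <oo) ((2 : R) / (2 ^ (J + 1))%:R)%:E)%E).
  apply: lee_nneseries => [J _ _|J _]; first exact: measure_ge0.
  apply: le_trans (measure_many_runless J small) _; rewrite lee_fin.
  by rewrite exprVn addn1 expnS natrM natrX invfM mulrA divff ?mul1r.
by rewrite (cvg_lim _ (@cvg_geometric_eseries_half R 2 0))// ltry.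
Qed.

End FewBadBlocks.

(** * Dimension of a limsup set of balls *)

Section Hausdorff.
Variable R : realType.
Implicit Types (z : cplx R) (r s : R).

Definition cball z r : set (cplx R) := [set w | Cdist z w <= r].

Lemma diam_cball z r : (diam (cball z r) <= (2 * r)%:E)%E.
Proof.
apply: ge_ereal_sup => _ [x [y [hx [hy ->]]]]; rewrite lee_fin.
by have := Cdist_tri z x y; rewrite (CdistC x z) /cball /= in hx hy *; lra.
Qed.

Lemma hterm_ge0 s (U : set (cplx R)) : 0 <= hterm s U.
Proof. by rewrite /hterm; case: asboolP => // _; exact: powR_ge0. Qed.

Lemma hterm_set0 s : hterm s (set0 : set (cplx R)) = 0.
Proof. by rewrite /hterm asboolT. Qed.

Lemma hterm_cball s z r : 0 <= s -> 0 <= r -> hterm s (cball z r) <= (2 * r) `^ s.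
Proof.
move=> s0 r0; rewrite /hterm; case: asboolP => [_|/eqP/set0P[x zx]]; first exact: powR_ge0.
have h2 := diam_cball z r.
have h1 : (0%:E <= diam (cball z r))%E.
  apply: ereal_sup_ubound; exists x, x; split => //; split => //.
  by rewrite /Cdist /Cnorm /= !subrr expr0n /= addr0 sqrtr0.
have fin : diam (cball z r) \is a fin_num.
  by rewrite ge0_fin_numE// (le_lt_trans h2)// ltry.
apply: ge0_ler_powR; rewrite ?nnegrE// ?mulr_ge0 ?fine_ge0//.
by rewrite -lee_fin fineK.
Qed.

(** The supremum of an empty family is -oo, so empty sets may pad a cover at no cost. *)
Lemma diam_set0 : (diam (set0 : set (cplx R)) = -oo)%E.
Proof.
rewrite /diam (_ : mkset _ = set0) ?ereal_sup0// -subset0 => x [y [z []]] //.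
Qed.

Lemma hcontent_ge0 s delta (E : set (cplx R)) : (0 <= hcontent s delta E)%E.
Proof.
apply: le_ereal_inf_tmp => _ [F _ <-]; apply: nneseries_ge0 => n _ _.
by rewrite lee_fin hterm_ge0.
Qed.

Lemma sum_geometric_le (C x : R) J0 M : 0 <= C -> 0 <= x -> x < 1 ->
  \sum_(J < M | (J0 <= J)%N) C * x ^+ J <= C * x ^+ J0 / (1 - x).
Proof.
move=> C0 x0 x1.
have y0 : 0 < 1 - x by lra.
rewrite ler_pdivlMr// big_distrl /=.
suff : \sum_(J < M | (J0 <= J)%N) C * x ^+ J * (1 - x)
    = if (J0 <= M)%N then C * (x ^+ J0 - x ^+ M) else 0.
  move=> ->; case: ifP => _; last by rewrite mulr_ge0// exprn_ge0.
  by rewrite ler_wpM2l// gerBl exprn_ge0.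
elim: M => [|M ih]; first by rewrite big_ord0; case: J0 => [|//] /=; rewrite subrr mulr0.
rewrite big_mkcond big_ord_recr /= -big_mkcond /= ih.
case: (leqP J0 M) => h; first by rewrite (leqW h) exprS; ring.
case: ifP => h'; last by rewrite addr0.
have -> : J0 = M.+1 by lia.
by rewrite subrr mulr0 addr0.
Qed.

(** The balls of all levels from J0 on cover E, and their s-costs are bounded by the tail of a
    geometric series, which tends to 0 with J0. *)
Lemma hdim_limsup_cball s (E : set (cplx R)) (k : nat -> nat)
    (ctr : nat -> nat -> cplx R) (r : nat -> R) (C x : R) :
  0 < s -> 0 <= C -> 0 <= x -> x < 1 -> (forall J, 0 <= r J) ->
  r @ \oo --> (0 : R) ->
  (forall J, (k J)%:R * (2 * r J) `^ s <= C * x ^+ J) ->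
  (forall z, E z -> forall J0, exists J, (J0 <= J)%N /\
     exists2 i, (i < k J)%N & Cdist (ctr J i) z <= r J) ->
  (hdim E <= s%:E)%E.
Proof.
move=> s0 C0 x0 x1 r0 rcvg kr cov.
apply: ereal_inf_lbound; exists s => //; split; first exact: ltW.
suff hc (delta : R) : 0 < delta -> hcontent s delta E = 0%E.
  rewrite /hmeasure (_ : [set hcontent s delta E | delta in _] = [set 0%E]) ?ereal_sup1//.
  apply/seteqP; split => y /=; first by case=> delta d0 <-; rewrite hc.
  by move=> ->; exists 1 => //=; exact: hc.
move=> d0; apply/eqP; rewrite eq_le hcontent_ge0 andbT.
apply/lee_addgt0Pr => e e0; rewrite add0e.
have y0 : 0 < 1 - x by lra.
have [J0 J0P] : exists J0, C * x ^+ J0 / (1 - x) <= e /\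
    forall J, (J0 <= J)%N -> 2 * r J <= delta.
  have d2 : 0 < delta / 2 by rewrite divr_gt0.
  move/cvgrPdist_le : rcvg => /(_ _ d2)[n1 _ h1].
  have : x ^+ n @[n --> \oo] --> (0 : R) by apply: cvg_expr; rewrite ger0_norm.
  have e2 : 0 < e * (1 - x) / (C + 1) by rewrite divr_gt0 ?mulr_gt0//; lra.
  move=> /cvgrPdist_le/(_ _ e2)[n2 _ h2].
  exists (maxn n1 n2); split.
    have /= := h2 (maxn n1 n2) (leq_maxr _ _).
    rewrite sub0r normrN ger0_norm ?exprn_ge0// ler_pdivlMr; last by lra.
    rewrite ler_pdivrMr//; apply: le_trans.
    by rewrite mulrC ler_wpM2l ?exprn_ge0//; lra.
  move=> J; rewrite geq_max => /andP[nJ _].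
  by have /= := h1 J nJ; rewrite sub0r normrN ger0_norm//; lra.
have [tail rd] := J0P => {J0P}.
(* The double family (level, index) is enumerated through pickling; codes without a ball receive the
   empty set. *)
pose F (n : nat) := if @pickle_inv (nat * nat)%type n is Some (J, i) then
  if ((J0 <= J) && (i < k J))%N then cball (ctr J i) (r J) else set0 else set0.
apply: le_trans (_ : (\sum_(n <oo) (hterm s (F n))%:E <= _)%E).
  apply: ereal_inf_lbound; exists F => //; split.
    move=> z /cov/(_ J0)[J [JJ [i iJ zi]]]; exists (pickle (J, i)) => //.
    by rewrite /F pickleK_inv JJ iJ.
  move=> n; rewrite /F; case: pickle_inv => [[J i]|]; last by rewrite diam_set0 leNye.
  case: ifP => [/andP[JJ _]|_]; last by rewrite diam_set0 leNye.
  by apply: le_trans (diam_cball _ _) _; rewrite lee_fin rd.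
apply: lime_le; first by apply: is_cvg_nneseries => n _ _; rewrite lee_fin hterm_ge0.
apply: nearW => n; rewrite sumEFin lee_fin big_mkord.
pose c J := (2 * r J) `^ s.
have c0 J : 0 <= c J by exact: powR_ge0.
pose lev (m : nat) := if @pickle_inv (nat * nat)%type m is Some (J, i) then J.+1 else 0%N.
(* [M] exceeds every level coded by an index below n ([lev] is J + 1 for strictness), so the partial
   sum fits into a finite double sum, where exchanging sums is allowed. *)
pose M := (\sum_(m < n) lev m)%N.
apply: le_trans tail; apply: le_trans (sum_geometric_le J0 M C0 x0 x1).
have pw (m : 'I_n) : hterm s (F m) <=
   \sum_(J < M | (J0 <= J)%N) \sum_(i < k J) (pickle (val J, val i) == m)%:R * c J.
  have nn J : 0 <= \sum_(i < k J) (pickle (J, val i) == m)%:R * c J.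
    by apply: sumr_ge0 => i _; rewrite mulr_ge0.
  have sn : 0 <= \sum_(J < M | (J0 <= J)%N) \sum_(i < k J) (pickle (val J, val i) == m)%:R * c J.
    by apply: sumr_ge0.
  rewrite /F; case E1 : (pickle_inv m) => [[J i]|]; last by rewrite hterm_set0.
  case: ifP => [/andP[JJ iJ]|_]; last by rewrite hterm_set0.
  have JM : (J < M)%N.
    rewrite /M (bigD1 m)//= {1}/lev E1; lia.
  apply: le_trans (hterm_cball _ (ltW s0) (r0 J)) _.
  rewrite (bigD1 (Ordinal JM))//= (bigD1 (Ordinal iJ))//=.
  have -> : pickle (J, i) = m by have := @pickle_invK (nat * nat)%type m; rewrite E1.
  rewrite eqxx mul1r -addrA lerDl addr_ge0//; apply: sumr_ge0 => ? _; last exact: nn.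
  by rewrite mulr_ge0// c0.
apply: le_trans (ler_sum _ (fun m _ => pw m)) _.
rewrite exchange_big /=; apply: ler_sum => J JJ.
rewrite exchange_big /=; apply: le_trans (kr J).
rewrite -[k J in leRHS]card_ord -sum1_card natr_sum big_distrl /=; apply: ler_sum => i _.
rewrite -big_distrl /= ler_wpM2r//.
case: (ltnP (pickle (val J, val i)) n) => h.
  rewrite (bigD1 (Ordinal h))//= eqxx big1 ?addr0// => m /negPf mh.
  by rewrite eq_sym -[in RHS](_ : (m == Ordinal h)%:R = 0) // mh.
rewrite big1// => m _; case: eqP => // e1.
by have := ltn_ord m; rewrite -e1 ltnNge h.
Qed.

End Hausdorff.

(** * Fourier transform of the random measure *)

Section NullSets.
Context (d : measure_display) (T : measurableType d) (R : realType).
Variable mu : probability T R.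
Import HBNNSimple.

(** The integral is a supremum over simple functions below f. Restricting such a function to the
    complement of N does not change its integral, so f itself need not be measurable. *)
Lemma ge0_integral_null (N : set T) (f : T -> \bar R) : measurable N -> mu N = 0%E ->
  (forall x, (0 <= f x)%E) -> (\int[mu]_x f x = \int[mu]_(x in ~` N) f x)%E.
Proof.
move=> mN N0 f0; have mC : measurable (~` N) by exact: measurableC.
rewrite ge0_integralTE// ge0_integralE//.
apply/eqP; rewrite eq_le; apply/andP; split; apply: ge_ereal_sup => _ [h hf <-].
  apply: ereal_sup_ubound; exists (proj_nnsfun h mC) => [x /=|].
    rewrite patchE /proj_nnsfun /= /mindic indicE.
    by case: (x \in _) => /=; rewrite ?mulr1 ?mulr0//; exact: hf.
  rewrite -!integralT_nnsfun [RHS](ge0_negligible_integral mN)//; last 2 first.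
  - by apply/measurable_EFinP.
  - by move=> x _; rewrite lee_fin.
  rewrite setTD integral_mkcond [RHS]integral_mkcond.
  apply: eq_integral => x _; rewrite !patchE /proj_nnsfun /= /mindic indicE in_setT.
  by case: (x \in _) => /=; rewrite ?mulr1 ?mulr0.
apply: ereal_sup_ubound; exists h => // x; apply: le_trans (hf x) _.
by rewrite patchE; case: ifP.
Qed.

(* f is arbitrary: it need not be measurable on N. *)
Lemma Rintegral_null (N : set T) (f : T -> R) : measurable N -> mu N = 0%E ->
  \int[mu]_x f x = \int[mu]_(x in ~` N) f x.
Proof.
move=> mN N0; rewrite /Rintegral; congr fine.
rewrite integralE [RHS]integralE.
by congr (_ - _)%E; apply: ge0_integral_null => // x; rewrite ?funepos_ge0 ?funeneg_ge0.
Qed.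

Lemma Rintegral_bounded_cvg (N : set T) (f_ : nat -> T -> R) (f : T -> R) (C : R) :
  measurable N -> mu N = 0%E -> (forall n, measurable_fun setT (f_ n)) ->
  (forall n x, `|f_ n x| <= C) -> (forall x, ~ N x -> f_ ^~ x @ \oo --> f x) ->
  \int[mu]_x f_ n x @[n --> \oo] --> \int[mu]_x f x.
Proof.
move=> mN N0 mf fC cf; rewrite (Rintegral_null _ mN N0).
have mC : measurable (~` N) by exact: measurableC.
have mfD n : measurable_fun (~` N) (f_ n) by apply: measurable_funTS.
have [|||||i _ cv] := @dominated_convergence _ _ _ mu (~` N) mC
   (fun n x => (f_ n x)%:E) (fun x => (f x)%:E) (fun=> C%:E).
- by move=> n; apply/measurable_EFinP.
- by apply/measurable_EFinP; apply: (measurable_fun_cvg mfD) => x; exact: cf.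
- by apply: aeW => x Nx; apply: cvg_EFin; [exact: nearW|exact: cf].
- apply: (@measurable_bounded_integrable _ _ _ mu (fun=> C)) => //.
    by apply: le_lt_trans (probability_le1 mu mC) _; rewrite ltry.
  by exists C; split; [exact: num_real|move=> M CM x _ /=; apply: le_trans (ltW CM);
    rewrite ger0_norm// (le_trans _ (fC 0%N point))].
- by apply: aeW => x n _; rewrite lee_fin.
under eq_cvg do rewrite (Rintegral_null _ mN N0).
apply: fine_cvg; rewrite fineK; first exact: cv.
exact: integrable_fin_num i.
Qed.

End NullSets.

(** * Characteristic function of a finite sum of independent phases *)

Section FourierProduct.
Variables (R : realType) (T : pointedType) (supp : nat -> seq T) (wt : nat -> T -> R).
Variable ph : nat -> T -> R.
Implicit Types w : seq T.

Let cosum n := \sum_(x <- supp n) wt n x * cos (ph n x).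
Let sisum n := \sum_(x <- supp n) wt n x * sin (ph n x).

Definition char_sqr n := cosum n ^+ 2 + sisum n ^+ 2.

Definition total_phase k w := \sum_(i < size w) ph (k + i) (nth point w i).

Lemma total_phase_cons k x w : total_phase k (x :: w) = ph k x + total_phase k.+1 w.
Proof.
rewrite /total_phase /= big_ord_recl /= addn0; congr (_ + _).
by apply: eq_bigr => i _; rewrite /bump /= add1n addnS addSn.
Qed.

(** X + iY is the product of the complex one-letter sums, and (X, Y) acts as a rotation and scaling
    of the starting phase. The arbitrary offset c makes the induction on the first letter work. *)
Lemma expect_phase k n : exists X Y : R,
  [/\ X ^+ 2 + Y ^+ 2 = \prod_(k <= m < k + n) char_sqr m,
    forall c, expect supp wt k n (fun w => cos (c + total_phase k w)) = cos c * X - sin c * Y &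
    forall c, expect supp wt k n (fun w => sin (c + total_phase k w)) = sin c * X + cos c * Y].
Proof.
elim: n k => [|n ih] k.
  exists 1, 0; split => [|c|c].
  - by rewrite addn0 big_geq// expr1n expr0n addr0.
  - by rewrite /= /total_phase big_ord0 addr0 mulr1 mulr0 subr0.
  - by rewrite /= /total_phase big_ord0 addr0 mulr1 mulr0 addr0.
have [X [Y [XY hc hs]]] := ih k.+1.
exists (cosum k * X - sisum k * Y), (sisum k * X + cosum k * Y); split => [|c|c].
- rewrite big_ltn; last by lia.
  by rewrite addnS -addSn -XY /char_sqr; ring.
- rewrite /=; under eq_bigr => x _.
    rewrite (_ : (fun w => _) = fun w => cos ((c + ph k x) + total_phase k.+1 w)); last first.
      by apply/funext => w; rewrite total_phase_cons addrA.
    rewrite hc cosD sinD.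
    rewrite [X in _ * X](_ : _ = cos (ph k x) * (cos c * X - sin c * Y)
       + sin (ph k x) * (- sin c * X - cos c * Y)); last by ring.
    rewrite mulrDr !mulrA; over.
  by rewrite big_split /= -!mulr_suml -/(cosum k) -/(sisum k); ring.
- rewrite /=; under eq_bigr => x _.
    rewrite (_ : (fun w => _) = fun w => sin ((c + ph k x) + total_phase k.+1 w)); last first.
      by apply/funext => w; rewrite total_phase_cons addrA.
    rewrite hs cosD sinD.
    rewrite [X in _ * X](_ : _ = cos (ph k x) * (sin c * X + cos c * Y)
       + sin (ph k x) * (cos c * X - sin c * Y)); last by ring.
    rewrite mulrDr !mulrA; over.
  by rewrite big_split /= -!mulr_suml -/(cosum k) -/(sisum k); ring.
Qed.

Lemma char_sqrE n : char_sqr n = \sum_(x <- supp n) \sum_(y <- supp n)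
  wt n x * wt n y * cos (ph n x - ph n y).
Proof.
rewrite /char_sqr !expr2 /cosum /sisum !big_distrlr -big_split /=.
apply: eq_bigr => x _; rewrite -big_split /=; apply: eq_bigr => y _.
by rewrite cosB; ring.
Qed.

(** The weights w_x w_y sum to 1 over all pairs, so the defect is a sum of nonnegative terms; a
    single pair then suffices to make a factor less than 1. *)
Lemma char_sqr_gap n : \sum_(x <- supp n) wt n x = 1 ->
  1 - char_sqr n = \sum_(x <- supp n) \sum_(y <- supp n)
    wt n x * wt n y * (1 - cos (ph n x - ph n y)).
Proof.
move=> w1; rewrite char_sqrE.
have e : \sum_(x <- supp n) \sum_(y <- supp n) wt n x * wt n y = 1.
  by rewrite -big_distrlr /= w1 mulr1.
rewrite -[X in X - _]e -sumrB; apply: eq_bigr => x _; rewrite -sumrB; apply: eq_bigr => y _.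
by rewrite mulrBr mulr1.
Qed.

Lemma char_sqr_le n : (forall x, 0 <= wt n x) -> \sum_(x <- supp n) wt n x = 1 ->
  char_sqr n <= 1.
Proof.
move=> w0 w1; rewrite -subr_ge0 char_sqr_gap//.
do 2![apply: sumr_ge0 => ? _]; rewrite !mulr_ge0// subr_ge0 cos_le1//.
Qed.

Lemma char_sqr_ge0 n : 0 <= char_sqr n.
Proof. by rewrite addr_ge0 ?sqr_ge0. Qed.

Lemma char_sqr_contract n x y (m kappa : R) : (forall x, 0 <= wt n x) ->
  \sum_(x <- supp n) wt n x = 1 -> x \in supp n -> y \in supp n ->
  0 <= m -> 0 <= kappa -> m <= wt n x -> m <= wt n y ->
  cos (ph n x - ph n y) <= 1 - kappa -> char_sqr n <= 1 - m ^+ 2 * kappa.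
Proof.
move=> w0 w1 xs ys m0 k0 mx my hc.
have nn u v : 0 <= wt n u * wt n v * (1 - cos (ph n u - ph n v)).
  by rewrite !mulr_ge0// subr_ge0 cos_le1.
suff : m ^+ 2 * kappa <= 1 - char_sqr n by lra.
rewrite char_sqr_gap// (big_rem x)//= (big_rem y)//= -addrA.
apply: le_trans (_ : wt n x * wt n y * (1 - cos (ph n x - ph n y)) <= _).
  by rewrite expr2 !ler_pM// ?mulr_ge0//; lra.
rewrite lerDl addr_ge0//; first by apply: sumr_ge0.
by do 2![apply: sumr_ge0 => ? _].
Qed.

End FourierProduct.

Section NotNear.
Variable R : realType.

Lemma cos_periodz (x : R) (k : int) : cos (x + (2 * pi) * k%:~R) = cos x.
Proof.
have step n (y : R) : cos (y + (2 * pi) * n%:R) = cos y.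
  elim: n y => [|n ih] y; first by rewrite mulr0 addr0.
  have -> : y + 2 * pi * n.+1%:R = (y + 2 * pi * n%:R) + pi *+ 2.
    by rewrite -natr1 mulr2n; ring.
  by rewrite cosD2pi ih.
case: k => n; first exact: step.
by rewrite NegzE mulrNz -[LHS](step n.+1) mulrN subrK.
Qed.

(** The fractional part lies in (rho, 1 - rho); by symmetry about 1/2 it may be taken in (rho, 1/2],
    where the cosine decreases. *)
Lemma cos_not_near (rho x : R) : 0 < rho -> rho <= 8^-1 -> ~ near_int rho x ->
  cos (2 * pi * x) <= cos (2 * pi * rho).
Proof.
move=> rho0 rho8 nx.
have p0 : 0 < pi :> R := pi_gt0 R.
have /andP[h1 h2] := floor_itv x.
set k := Num.floor x in h1 h2; pose y := x - k%:~R.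
have y1 : rho < y.
  rewrite ltNge; apply/negP => h; apply: nx; exists k; rewrite ger0_norm ?subr_ge0//.
have y2 : rho < 1 - y.
  rewrite ltNge; apply/negP => h; apply: nx; exists (k + 1).
  rewrite ler0_norm; last by rewrite subr_le0 ltW.
  by apply: le_trans h; rewrite /y intrD; lra.
have -> : cos (2 * pi * x) = cos (2 * pi * y).
  by rewrite -(cos_periodz (2 * pi * y) k); congr cos; rewrite /y; ring.
have dec (u v : R) : 0 <= u -> u <= v -> v <= 2^-1 -> cos (2 * pi * v) <= cos (2 * pi * u).
  move=> u0 uv v2.
  have bnd w : 0 <= w -> w <= 2^-1 -> 2 * pi * w \in `[(0:R), pi].
    by move=> w0 w2; rewrite in_itv /=; apply/andP; split; nra.
  case: (ltgtP u v) uv => // [uv _|-> _ //].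
  apply: ltW; rewrite (ltr_cos (bnd _ _ _) (bnd _ _ _)) ?(ltr_pM2l)//; try lra.
case: (leP y 2^-1) => hy; first by apply: dec; lra.
have -> : cos (2 * pi * y) = cos (2 * pi * (1 - y)).
  rewrite -(cosN (2 * pi * (1 - y))) -(cos_periodz (- _) 1).
  by congr cos; rewrite mulr1z; ring.
by apply: dec; lra.
Qed.

Lemma cos_gap (rho : R) : 0 < rho -> rho <= 8^-1 -> 0 < 1 - cos (2 * pi * rho).
Proof.
move=> rho0 rho8; have p0 : 0 < pi :> R := pi_gt0 R.
rewrite subr_gt0 -[ltRHS]cos0 ltr_cos ?in_itv /=; first by nra.
- by apply/andP; split; nra.
- by apply/andP; split; nra.
Qed.

End NotNear.

Lemma expect_supp (R : realType) (T : pointedType) (supp : nat -> seq T)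
    (wt : nat -> T -> R) k n (F : seq T -> R) :
  (forall w, size w = n -> (forall i, (i < n)%N -> nth point w i \in supp (k + i)%N) ->
     F w = 0) -> expect supp wt k n F = 0.
Proof.
elim: n k F => [|n ih] k F h /=; first by apply: h.
rewrite big_seq big1// => x xs; rewrite ih ?mulr0// => w sw hw.
apply: h => [|[|i] //=]; first by rewrite /= sw.
  by rewrite addn0.
by rewrite ltnS addnS -addSn; exact: hw.
Qed.

(** * The random measure as a limit of its finite truncations *)

Section ModelFourier.
Variables (R : realType) (N : nat).
Local Notation I := 'I_N.+1.
Variables (k : I -> nat) (lam : I -> cplx R) (t : I -> nat -> cplx R) (p : I -> nat -> R).
Variables (om : nat -> I) (Q : probability USpace R) (xi : cplx R).

Definition digits n := iota 0 (k (om n)).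
Definition digit_weight n j := if (j < k (om n))%N then p (om n) j else 0.
Definition summand n j : cplx R := Cmul (lamprod lam om n) (t (om n) j).
Definition phase n j : R :=
  2 * pi * ((summand n j).1 * xi.1 + (summand n j).2 * xi.2).

Local Notation chi := (char_sqr digits digit_weight phase).

Hypotheses (model : planar_model k lam t p) (law : coding_law k p om Q).

Lemma digit_weight_ge0 n j : 0 <= digit_weight n j.
Proof.
by rewrite /digit_weight; case: ifP => // h; apply: ltW; have [_ [+ _]] := model (om n); apply.
Qed.

Lemma digit_weight_sum n : \sum_(x <- digits n) digit_weight n x = 1.
Proof.
have [_ [_ <-]] := model (om n).
rewrite /digits -[X in iota 0 X]subn0 -/(index_iota 0 (k (om n))) big_mkord.
by apply: eq_bigr => i _; rewrite /digit_weight ltn_ord.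
Qed.

Lemma cylinder_law (v : seq nat) : Q (cylinder v) = (weight digit_weight v)%:E.
Proof. by rewrite cylinderE (law (size v) (nth point v)). Qed.

Lemma USpace_integral n (F : seq nat -> R) (C : R) : (forall w, `|F w| <= C) ->
  \int[Q]_u F (mkseq u n) = expect digits digit_weight 0 n F.
Proof.
apply: (@integral_prefix R nat id).
- by move=> ? ?.
- by move=> m; exact: iota_uniq.
- exact: digit_weight_sum.
- exact: cylinder_law.
Qed.

(** Sequences with a digit outside its range. There the values of [t] are unconstrained and the
    series may diverge, so this null set has to be removed before passing to the limit. *)
Definition off_support : set USpace := [set u : USpace | exists n, (k (om n) <= u n)%N].

Let off_at n : set USpace := [set u : USpace |
  [set w | (k (om n) <= nth point w n)%N] (mkseq u n.+1)].

Let off_supportE : off_support = \bigcup_n off_at n.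
Proof.
apply/seteqP; split => u /=.
  by move=> [n h]; exists n => //; rewrite /off_at /= nth_mkseq.
by move=> [n _]; rewrite /off_at /= nth_mkseq// => h; exists n.
Qed.

Lemma measurable_off_support : measurable off_support.
Proof.
rewrite off_supportE; apply: bigcupT_measurable => n.
by apply: (measurable_prefix (code := id)) => ? ?.
Qed.

Lemma off_support_null : Q off_support = 0%E.
Proof.
apply/negligibleP; first exact: measurable_off_support.
rewrite off_supportE; apply: negligible_bigcup => n; apply/negligibleP.
  by apply: (measurable_prefix (code := id)) => ? ?.
have e := @measure_prefix R nat id (fun _ _ => id) Q digits digit_weight
  (fun m => iota_uniq 0 _) digit_weight_sum cylinder_law
  n.+1 [set w | (k (om n) <= nth point w n)%N].
apply: etrans; first exact: e.
rewrite expect_supp// => w sw /(_ n (ltnSn _)); rewrite mem_iota /= !add0n => h.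
by case: asboolP => //=; rewrite leqNgt h.
Qed.

Lemma total_phase_mkseq (u : nat -> nat) n : total_phase phase 0 (mkseq u n) =
  2 * pi * ((\sum_(i < n) (summand i (u i)).1) * xi.1
          + (\sum_(i < n) (summand i (u i)).2) * xi.2).
Proof.
rewrite /total_phase size_mkseq !big_distrl /= -big_split /= big_distrr /=.
by apply: eq_bigr => i _; rewrite nth_mkseq.
Qed.

Variable r : R.
Hypotheses (r1 : r < 1) (lam_le : forall i, Cnorm (lam i) <= r).

Lemma Cnorm_lamprod n : Cnorm (lamprod lam om n) <= r ^+ n.
Proof.
elim: n => [|n ih]; first by rewrite /lamprod big_ord0 Cnorm1.
by rewrite /lamprod big_ord_recr /= CnormM exprSr ler_pM ?Cnorm_ge0.
Qed.

Let r0 : 0 <= r. Proof. exact: le_trans (Cnorm_ge0 _) (lam_le ord0). Qed.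

Lemma summand_bound : exists2 C, 0 <= C &
  forall n j, (j < k (om n))%N -> Cnorm (summand n j) <= C * r ^+ n.
Proof.
pose C := \sum_i \sum_(j < k i) Cnorm (t i j); exists C.
  by do 2![apply: sumr_ge0 => ? _]; exact: Cnorm_ge0.
move=> n j jk; rewrite CnormM mulrC ler_pM ?Cnorm_ge0 ?Cnorm_lamprod//.
rewrite /C (bigD1 (om n))//= (bigD1 (Ordinal jk))//= -addrA lerDl.
rewrite addr_ge0//; first by apply: sumr_ge0 => ? _; exact: Cnorm_ge0.
by do 2![apply: sumr_ge0 => ? _]; exact: Cnorm_ge0.
Qed.

Lemma series_cvg_geometric (f : nat -> R) (C : R) : (forall n, `|f n| <= C * r ^+ n) ->
  (fun n => \sum_(i < n) f i) @ \oo --> limn (fun n => \sum_(i < n) f i).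
Proof.
move=> hf.
have -> : (fun n => \sum_(i < n) f i) = series f.
  by apply/funext => n; rewrite /series /= big_mkord.
apply: (normed_cvg (V := R^o)).
apply: (@series_le_cvg R (fun n => `|f n|) (geometric C r)) => //.
- by move=> n; apply: le_trans (hf n).
- by apply: is_cvg_geometric_series; rewrite ger0_norm.
Qed.

Lemma total_phase_cvg (u : USpace) : ~ off_support u ->
  total_phase phase 0 (mkseq u n) @[n --> \oo] -->
  2 * pi * ((rpoint lam t om u).1 * xi.1 + (rpoint lam t om u).2 * xi.2).
Proof.
move=> hu; have [C C0 hC] := summand_bound.
have uk n : (u n < k (om n))%N.
  by rewrite ltnNge; apply/negP => h; apply: hu; exists n.
under eq_cvg do rewrite total_phase_mkseq.
apply: cvgMr; apply: cvgD; apply: cvgMl.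
  apply: (@series_cvg_geometric (fun n => (summand n (u n)).1) C) => n.
  exact: le_trans (Cnorm_re _) (hC _ _ (uk n)).
apply: (@series_cvg_geometric (fun n => (summand n (u n)).2) C) => n.
exact: le_trans (Cnorm_im _) (hC _ _ (uk n)).
Qed.

(** Bounded convergence reduces the claim to truncations of length n >= M, whose squared transform
    is the product of n factors in [0, 1]; those beyond M are dropped. *)
Lemma fourier_le_prod M :
  law_fourier_abs Q (rpoint lam t om) xi ^+ 2 <= \prod_(0 <= m < M) chi m.
Proof.
rewrite /law_fourier_abs /= sqr_sqrtr ?addr_ge0 ?sqr_ge0//.
pose ph (u : USpace) := 2 * pi * ((rpoint lam t om u).1 * xi.1 + (rpoint lam t om u).2 * xi.2).
have lim (g : R -> R) : continuous g -> (forall x, `|g x| <= 1) ->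
    \int[Q]_u g (total_phase phase 0 (mkseq u n)) @[n --> \oo] --> \int[Q]_u g (ph u).
  move=> cg g1; apply: (Rintegral_bounded_cvg measurable_off_support off_support_null
    (C := 1)) => [n|//|u hu].
    exact: (@measurable_prefix_fun R nat id (fun _ _ => id) n (fun w => g (total_phase phase 0 w))).
  by apply: continuous_cvg; [exact: cg|exact: total_phase_cvg].
have b1 (g : R -> R) : (forall x, -1 <= g x) -> (forall x, g x <= 1) -> forall x, `|g x| <= 1.
  by move=> h1 h2 x; rewrite ler_norml h1 h2.
have bc := b1 _ (@cos_geN1 R) (@cos_le1 R); have bs := b1 _ (@sin_geN1 R) (@sin_le1 R).
have lc := lim _ (@continuous_cos R) bc; have ls := lim _ (@continuous_sin R) bs.
pose Ec n := \int[Q]_u cos (total_phase phase 0 (mkseq u n)).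
pose Es n := \int[Q]_u sin (total_phase phase 0 (mkseq u n)).
have lcs : (fun n => Ec n * Ec n + Es n * Es n) @ \oo -->
    \int[Q]_u cos (ph u) * \int[Q]_u cos (ph u) + \int[Q]_u sin (ph u) * \int[Q]_u sin (ph u).
  by apply: cvgD; apply: cvgM.
rewrite !expr2 -[leLHS](cvg_lim (@Rhausdorff R) lcs)//; apply: limr_le; first by apply/cvg_ex; eexists; exact: lcs.
exists M => // n /= Mn; rewrite /Ec /Es.
rewrite (USpace_integral n (F := fun w => cos (total_phase phase 0 w)) (fun w => bc _)).
rewrite (USpace_integral n (F := fun w => sin (total_phase phase 0 w)) (fun w => bs _)).
have [X [Y [XY hc hs]]] := expect_phase digits digit_weight phase 0 n.
have := hc 0; have := hs 0; rewrite sin0 cos0 !mul0r !mul1r subr0 add0r.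
under eq_fun do rewrite add0r.
move=> ->; under eq_fun do rewrite add0r.
move=> ->; rewrite -!expr2 XY add0n (big_cat_nat _ Mn)//= ler_piMr//.
  by apply: prodr_ge0 => i _; exact: char_sqr_ge0.
rewrite prodr_ile1// => i _; rewrite char_sqr_ge0 char_sqr_le//.
- exact: digit_weight_ge0.
- exact: digit_weight_sum.
Qed.

End ModelFourier.

(** * Contraction of the Fourier transform by blocks with a run that are not good *)

Section BlockDecay.
Variables (R : realType) (N : nat) (beta : 'I_N.+1 -> cplx R).
Local Notation I := 'I_N.+1.
Variables (k : I -> nat) (t : I -> nat -> cplx R) (p : I -> nat -> R) (th : cplx R).
Variables (om : nat -> I) (Q : probability USpace R) (xi : cplx R).
Variables (j0 j1 : nat) (pmin rho r : R) (l : nat).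
Local Notation lam := (contraction beta th).
Local Notation chi := (char_sqr (digits k om) (digit_weight k p om) (phase lam t om xi)).

(** The product of t_j0 - t_j1 with the conjugate of xi: real parts along its orbit are phase
    differences divided by 2 pi. *)
Definition frequency : cplx R :=
  Cmul ((t ord0 j0).1 - (t ord0 j1).1, (t ord0 j0).2 - (t ord0 j1).2) (xi.1, - xi.2).

Local Notation s := (th, frequency).

Hypotheses (model : planar_model k lam t p) (law : coding_law k p om Q)
  (r1 : r < 1) (lam_le : forall i, Cnorm (lam i) <= r)
  (j0k : (j0 < k ord0)%N) (j1k : (j1 < k ord0)%N)
  (pmin0 : 0 < pmin) (pminP : forall j, (j < k ord0)%N -> pmin <= p ord0 j)
  (rho0 : 0 < rho) (rho8 : rho <= 8^-1).

Lemma phase_diff n : om n = ord0 -> phase lam t om xi n j0 - phase lam t om xi n j1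
  = 2 * pi * (orbit beta om n s).1.
Proof.
move=> e; rewrite /phase /summand e /orbit /frequency /=.
case: (lamprod _ _ _) => u v /=; case: (t ord0 j0) => x y; case: (t ord0 j1) => z w /=.
rewrite /Cmul /=; ring.
Qed.

(** The maximum with 1/2 only secures positivity, since the decay exponent involves the logarithm of
    the rate. *)
Definition contract_rate : R := Num.max 2^-1 (1 - pmin ^+ 2 * (1 - cos (2 * pi * rho))).

Lemma contract_rate_gt0 : 0 < contract_rate.
Proof. by rewrite lt_max invr_gt0 ltr0n. Qed.

Lemma contract_rate_lt1 : contract_rate < 1.
Proof.
rewrite gt_max; apply/andP; split; first by rewrite invf_lt1 ?ltr1n.
by rewrite ltrBlDr ltrDl mulr_gt0 ?exprn_gt0 ?cos_gap.
Qed.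

Lemma chi_ge0_le1 n : 0 <= chi n <= 1.
Proof.
rewrite char_sqr_ge0 char_sqr_le//; last exact: digit_weight_sum model _.
exact: digit_weight_ge0 model _.
Qed.

Lemma chi_contract n : om n = ord0 -> ~ near_int rho (orbit beta om n s).1 ->
  chi n <= contract_rate.
Proof.
move=> e nn; rewrite le_max; apply/orP; right.
apply: (@char_sqr_contract _ _ _ _ _ n j0 j1).
- exact: digit_weight_ge0 model _.
- exact: digit_weight_sum model _.
- by rewrite mem_iota e.
- by rewrite mem_iota e.
- exact: ltW.
- exact: ltW (cos_gap rho0 rho8).
- by rewrite /digit_weight e j0k pminP.
- by rewrite /digit_weight e j1k pminP.
- rewrite opprB addrCA subrr addr0 phase_diff//; exact: cos_not_near.
Qed.

Lemma prod_le_factor (F : nat -> R) a b m : (forall i, 0 <= F i <= 1) ->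
  (a <= m < b)%N -> \prod_(a <= i < b) F i <= F m.
Proof.
move=> hF /andP[am mb]; rewrite (big_cat_nat am (ltnW mb)) /=.
rewrite (big_ltn mb) mulrCA ler_piMr//; first by have /andP[] := hF m.
by rewrite mulr_ile1 ?prodr_ge0 ?prodr_ile1// => i _; have /andP[] := hF i.
Qed.

(** The failure occurs at one of the four times of an aligned run. The letter there is [ord0], so
    the factor at that time contracts, and all the others are at most 1. *)
Lemma block_contract j : has_run l om j -> ~ good_block beta rho l om j s ->
  \prod_(j * (4 * l) <= m < j.+1 * (4 * l)) chi m <= contract_rate.
Proof.
move=> hr ng.
have [i [il run nn]] : exists i, [/\ (i < l)%N, run_at om (j * (4 * l) + 4 * i) &
    ~ near_run beta rho om (j * (4 * l) + 4 * i) s].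
  apply: contrapT => h; apply: ng; split => // i il run.
  by apply: contrapT => nn; apply: h; exists i.
have [i' [i4 ni]] : exists i', (i' < 4)%N /\
    ~ near_int rho (orbit beta om (j * (4 * l) + 4 * i + i') s).1.
  apply: contrapT => h; apply: nn => i' i4.
  by apply: contrapT => nn; apply: h; exists i'.
apply: le_trans (@prod_le_factor _ _ _ (j * (4 * l) + 4 * i + i')%N chi_ge0_le1 _) _.
  by rewrite mulSn; apply/andP; split; lia.
apply: chi_contract => //; apply/eqP; apply: (allP run).
by rewrite mem_iota.
Qed.

Definition contract_count J :=
  (\sum_(j < J) (has_run l om j && ~~ `[< good_block beta rho l om j s >]))%N.

Lemma fourier_block_decay J :
  law_fourier_abs Q (rpoint lam t om) xi ^+ 2 <= contract_rate ^+ contract_count J.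
Proof.
apply: le_trans (fourier_le_prod xi model law r1 lam_le (J * (4 * l))) _.
rewrite big_nat_mul big_mkord /contract_count -prodrXr; apply: ler_prod => j _.
have nn : 0 <= \prod_(j * (4 * l) <= m < j.+1 * (4 * l)) chi m <= 1.
  apply/andP; split; last by apply: prodr_ile1 => i _; exact: chi_ge0_le1.
  by apply: prodr_ge0 => i _; have /andP[] := chi_ge0_le1 i.
have /andP[n0 n1] := nn; rewrite n0 /=.
case: (boolP (has_run l om j)) => //= hr; case: asboolP => //= ng.
exact: block_contract.
Qed.

Lemma fourier_le1 : law_fourier_abs Q (rpoint lam t om) xi <= 1.
Proof.
have := fourier_le_prod xi model law r1 lam_le 0; rewrite big_geq//.
by rewrite expr_le1// sqrtr_ge0.
Qed.

Lemma bad_count_le J : (bad_count beta rho l om s 0 J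
  <= runless_count l om J + contract_count J)%N.
Proof.
rewrite /bad_count /runless_count /contract_count big_mkord -big_split /=.
by apply: leq_sum => j _; case: has_run; case: asboolP.
Qed.

Lemma Cnorm_frequency : Cnorm frequency = Cdist (t ord0 j0) (t ord0 j1) * Cnorm xi.
Proof. by rewrite CnormM /Cdist; congr (_ * _); rewrite /Cnorm /= sqrrN. Qed.

End BlockDecay.

Lemma eq_good_block (R : realType) N (beta : 'I_N.+1 -> cplx R) rho l om om' s J j :
  (forall m, (m < J * (4 * l))%N -> om m = om' m) -> (j < J)%N ->
  good_block beta rho l om j s -> good_block beta rho l om' j s.
Proof.
move=> h jJ.
have hb i : (i < l)%N -> (j * (4 * l) + 4 * i + 4 <= J * (4 * l))%N by nia.
have hrun i : (i < l)%N -> run_at om (j * (4 * l) + 4 * i) = run_at om' (j * (4 * l) + 4 * i).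
  move=> il; apply: eq_in_all => i'; rewrite mem_iota => /andP[_ i4].
  by rewrite h//; have := hb _ il; lia.
move=> [hr g]; split.
  rewrite /has_run -(eq_in_has (a1 := fun i => run_at om (j * (4 * l) + 4 * i)))// => i.
  by rewrite mem_iota => /andP[_ il]; exact: hrun.
move=> i il; rewrite -hrun// => run i' i4.
have := g i il run i' i4; rewrite (@eq_orbit _ _ beta om om')// => m mm.
by apply: h; have := hb _ il; lia.
Qed.

(** Only a finite prefix of omega matters, so omega may be replaced by that prefix continued
    arbitrarily; this allows covers indexed by words. *)
Lemma eq_bad_count (R : realType) N (beta : 'I_N.+1 -> cplx R) rho l om om' s J :
  (forall m, (m < J * (4 * l))%N -> om m = om' m) ->
  bad_count beta rho l om s 0 J = bad_count beta rho l om' s 0 J.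
Proof.
move=> h; rewrite /bad_count !big_mkord; apply: eq_bigr => j _; congr (nat_of_bool (~~ _)).
apply/asboolP/asboolP; apply: (eq_good_block (J := J)) => // m mm.
by rewrite h.
Qed.

(** * The exceptional set *)

Section Measurability.
Variables (R : realType) (N : nat).
Local Notation I := 'I_N.+1.

Lemma measurable_le_set d (T : measurableType d) (f g : T -> R) :
  measurable_fun setT f -> measurable_fun setT g -> measurable [set x | f x <= g x].
Proof.
move=> mf mg; have := measurable_fun_ler mf mg measurableT (Y := [set true]).
by rewrite setTI; apply.
Qed.

Let sqdist (c : cplx R) (z : cplx R) := (z.1 - c.1) ^+ 2 + (z.2 - c.2) ^+ 2.

Let measurable_sqdist c : measurable_fun setT (sqdist c : cplx R -> R).
Proof.
apply: measurable_funD; apply: measurable_funX; apply: measurable_funB => //.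
Qed.

Lemma measurable_cball (c : cplx R) r : 0 <= r -> measurable (cball c r).
Proof.
move=> r0; rewrite (_ : cball c r = [set z | sqdist c z <= r ^+ 2]).
  exact: measurable_le_set (measurable_sqdist c) _.
apply/seteqP; split => z; rewrite /cball /= CdistC /Cdist => h.
  by have := h; rewrite -(@ler_pXn2r _ 2)// ?nnegrE ?Cnorm_ge0// Cnorm_sqr.
by rewrite -(@ler_pXn2r _ 2)// ?nnegrE ?Cnorm_ge0// Cnorm_sqr.
Qed.

Lemma measurable_annulus (a b eta : R) : 0 <= a -> 0 <= b -> measurable (annulus a b eta).
Proof.
move=> a0 b0; rewrite (_ : annulus a b eta = [set z | a ^+ 2 <= sqdist (0, 0) z] `&`
  [set z | sqdist (0, 0) z <= b ^+ 2] `&` ~` [set z | z.2 <= eta]).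
  apply: measurableI; first by apply: measurableI; exact: measurable_le_set.
  by apply: measurableC; apply: measurable_le_set.
have sq (z : cplx R) : sqdist (0, 0) z = Cnorm z ^+ 2 by rewrite Cnorm_sqr /sqdist /= !subr0.
apply/seteqP; split => z; rewrite /annulus /= sq ler_pXn2r ?nnegrE ?Cnorm_ge0//.
  rewrite ler_pXn2r ?nnegrE ?Cnorm_ge0// => -[/andP[h1 h2] h3]; split => //.
  by apply/negP; rewrite -ltNge.
rewrite ler_pXn2r ?nnegrE ?Cnorm_ge0// => -[[-> ->] h3]; split => //.
by rewrite ltNge; apply/negP.
Qed.

Lemma measurable_words n (E : seq I -> set (cplx R)) : (forall v, measurable (E v)) ->
  measurable [set x : OmegaT N * cplx R | E (mkseq x.1 n) x.2].
Proof.
move=> mE.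
pose F c : set (OmegaT N * cplx R) := if @unpickle (seq I) c is Some v then
  [set om : OmegaT N | [set w | w = v] (mkseq om n)] `*` E v else set0.
rewrite (_ : mkset _ = \bigcup_c F c).
  apply: bigcupT_measurable => c; rewrite /F; case: unpickle => // v.
  apply: measurableX => //; apply: (measurable_prefix (code := @nat_of_ord _)).
  exact: ord_inj.
apply/seteqP; split => -[om z] /=.
  by move=> h; exists (pickle (mkseq om n)) => //; rewrite /F pickleK; split.
by move=> [c _]; rewrite /F; case: unpickle => // v [/= ->].
Qed.

End Measurability.

(** * From block counts to decay rates and dimension *)

Lemma expr_unbounded (R : realType) (g x : R) : 1 < g -> exists m : nat, x < g ^+ m.
Proof.
move=> g1; have g0 : 0 < g := lt_trans ltr01 g1.
have : (g^-1) ^+ n @[n --> \oo] --> (0 : R).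
  by apply: cvg_expr; rewrite gtr0_norm ?invr_gt0// invf_lt1.
have x0 : 0 < `|x| + 1 by rewrite ltr_wpDl.
have e0 : 0 < (`|x| + 1)^-1 by rewrite invr_gt0.
move=> /cvgrPdist_lt/(_ _ e0)[m _ /(_ m (leqnn m))] /=.
rewrite sub0r normrN exprVn gtr0_norm ?invr_gt0 ?exprn_gt0//.
rewrite ltf_pV2 ?posrE ?exprn_gt0// => h.
exists m; apply: le_lt_trans (ler_norm x) _; apply: lt_trans h; by rewrite ltrDl.
Qed.

(** J is the last block boundary where the orbit still has modulus at least 1. One block later it is
    below 1, which gives both upper bounds. *)
Lemma select_level (R : realType) N (beta : 'I_N.+1 -> cplx R) (a b eta : R) l om s J1 :
  1 < a -> a < b -> (0 < l)%N -> admissible beta a b eta s.1 ->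
  b ^+ (J1 * (4 * l)) <= Cnorm s.2 ->
  exists J, [/\ (J1 <= J)%N, 1 <= Cnorm (orbit beta om (J * (4 * l)) s) <= b ^+ (4 * l) &
    Cnorm s.2 <= b ^+ (J.+1 * (4 * l))].
Proof.
move=> a1 ab l0 adm big.
have a0 : 0 < a by lra. have b0 : 0 < b by lra.
pose X J := Cnorm (orbit beta om (J * (4 * l)) s).
have grow J : a ^+ (J * (4 * l)) * X J <= Cnorm s.2 <= b ^+ (J * (4 * l)) * X J.
  by have := orbit_growth om 0 (J * (4 * l)) a0 adm; rewrite add0n orbit0.
have exP : exists J, 1 <= X J.
  exists J1; have /andP[_ h] := grow J1.
  have := le_trans big h; rewrite ler_pMr// exprn_gt0//.
have [m am] := expr_unbounded (Cnorm s.2) a1.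
have ub J : 1 <= X J -> (J <= m)%N.
  move=> h; rewrite leqNgt; apply/negP => mJ.
  have /andP[g _] := grow J.
  have : a ^+ m <= Cnorm s.2.
    apply: le_trans g; apply: le_trans (_ : a ^+ (J * (4 * l)) <= _).
      by apply: ler_weXn2l; [exact: ltW|nia].
    by rewrite ler_pMr// exprn_gt0.
  by rewrite leNgt am.
case: (ex_maxnP exP ub) => J PJ maxJ; exists J.
have lt1 : X J.+1 < 1.
  by rewrite ltNge; apply/negP => /maxJ; rewrite ltnn.
split.
- apply: maxJ; have /andP[_ h] := grow J1.
  by have := le_trans big h; rewrite ler_pMr// exprn_gt0.
- rewrite PJ /=; have /andP[_ h] := orbit_growth om (J * (4 * l)) (4 * l) a0 adm.
  apply: le_trans h _; rewrite ler_piMr ?exprn_ge0 ?(ltW b0)//.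
  by apply: ltW; rewrite addnC -mulSn.
- have /andP[_ h] := grow J.+1; apply: le_trans h _.
  by rewrite ler_piMr ?exprn_ge0 ?(ltW b0)// ltW.
Qed.

(** F is at most c^(J / 4e): one factor 2 comes from the square on F, the other from cnt >= J / 2e.
    Since J + 1 >= ln X / (L ln b), this is a power of X; the loss of one block gives the
    exponential constant. *)
Lemma power_decay (R : realType) (F c b X : R) (e L cnt J : nat) :
  0 <= F -> 0 < c -> c < 1 -> 1 < b -> 0 < X -> (0 < e)%N -> (0 < L)%N ->
  F ^+ 2 <= c ^+ cnt -> (J <= 2 * e * cnt)%N -> X <= b ^+ (J.+1 * L) ->
  F <= expR (- ln c / (4 * e%:R)) * X `^ (- (- ln c / (4 * e%:R * (L%:R * ln b)))).
Proof.
move=> F0 c0 c1 b1 X0 e0 L0 Fc Jc Xb.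
have lc : ln c < 0 by rewrite ln_lt0// c0.
have lb : 0 < ln b by rewrite ln_gt0.
have e0' : 0 < e%:R :> R by rewrite ltr0n.
have L0' : 0 < L%:R :> R by rewrite ltr0n.
have [->|Fn0] := eqVneq F 0; first by rewrite mulr_ge0 ?expR_ge0 ?powR_ge0.
have Fp : 0 < F by rewrite lt_def Fn0.
rewrite /powR gt_eqF// -expRD -[leLHS](lnK Fp) ler_expR.
have h1 : 4 * e%:R * ln F <= J%:R * ln c.
  have : ln (F ^+ 2) <= ln (c ^+ cnt) by rewrite ler_ln ?posrE ?exprn_gt0.
  rewrite !lnXn// -[ln F *+ 2]mulr_natl -[ln c *+ cnt]mulr_natl => h.
  have Jc' : J%:R <= 2 * e%:R * cnt%:R :> R by rewrite -!natrM ler_nat.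
  have := ler_wnM2r (ltW lc) Jc'.
  have := ler_wpM2l (ltW (mulr_gt0 (ltr0Sn _ 1) e0')) h.
  by clear; lra.
have h2 : ln X <= (J%:R + 1) * (L%:R * ln b).
  have b0 : 0 < b := lt_trans ltr01 b1.
  by rewrite natr1 mulrA -natrM mulr_natl -lnXn// ler_ln ?posrE// exprn_gt0.
have E0 : 0 < 4 * e%:R :> R by rewrite mulr_gt0.
have D0 : 0 < L%:R * ln b by rewrite mulr_gt0.
rewrite -(ler_pM2l E0).
have -> : 4 * e%:R * (- ln c / (4 * e%:R) + - (- ln c / (4 * e%:R * (L%:R * ln b))) * ln X)
   = - ln c + ln c * (ln X / (L%:R * ln b)).
  field; rewrite !gt_eqF//.
have : ln X / (L%:R * ln b) <= J%:R + 1 by rewrite ler_pdivrMr.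
by move=> /(ler_wnM2l (ltW lc)); move: h1; clear; lra.
Qed.

(** 8 B^L + 1 <= 9 B^L <= (9B)^L, so a bad block costs at most g^(eL), and J / e of them at most
    g^(JL), with e chosen independently of L. The positions cost at most g^J. *)
Lemma cover_growth (R : realType) (g : R) (A B L e J : nat) : 1 <= g ->
  (0 < A)%N -> (0 < B)%N -> (0 < L)%N -> 1 + A%:R^-1 <= g ->
  ((9 * B) ^ 4 * A)%:R <= g ^+ e ->
  ((8 * B ^ L).+1 ^ 4 * A)%:R ^+ (J %/ e) * (1 + A%:R^-1) ^+ J <= g ^+ (2 * (J * L)).
Proof.
move=> g1 A0 B0 L0 Ag Yg; set m := (J %/ e)%N.
have BL : (0 < B ^ L)%N by rewrite expn_gt0 B0.
have nat_le : ((8 * B ^ L).+1 ^ 4 * A <= ((9 * B) ^ 4 * A) ^ L)%N.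
  rewrite expnMn leq_mul//; last first.
    by case: L L0 {BL} => // L _; rewrite expnS leq_pmulr// expn_gt0 A0.
  have -> : (((9 * B) ^ 4) ^ L = ((9 * B) ^ L) ^ 4)%N by rewrite -!expnM (mulnC 4).
  rewrite leq_exp2r// expnMn.
  apply: (@leq_trans (9 * B ^ L)); first by lia.
  by rewrite leq_mul2r; apply/orP; right; case: L L0 {BL} => // L _; rewrite expnS leq_pmulr// expn_gt0.
have g0 : 0 <= g := le_trans ler01 g1.
have -> : g ^+ (2 * (J * L)) = g ^+ (J * L) * g ^+ (J * L) by rewrite mul2n -addnn exprD.
apply: ler_pM; rewrite ?exprn_ge0 ?addr_ge0 ?invr_ge0//.
  apply: le_trans (_ : (g ^+ e) ^+ (L * m) <= _).
    rewrite exprM; apply: lerXn2r; rewrite ?nnegrE ?exprn_ge0//.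
    apply: le_trans (_ : (((9 * B) ^ 4 * A) ^ L)%:R <= _); first by rewrite ler_nat.
    by rewrite natrX; apply: lerXn2r; rewrite ?nnegrE ?exprn_ge0.
  rewrite -exprM; apply: ler_weXn2l => //.
  by rewrite mulnCA mulnC leq_mul2r mulnC leq_trunc_div orbT.
apply: le_trans (_ : g ^+ J <= _).
  by apply: lerXn2r; rewrite ?nnegrE ?addr_ge0 ?invr_ge0.
by apply: ler_weXn2l => //; rewrite leq_pmulr.
Qed.

(** With g = a^(alpha/4) there are O(g^(2JL)) balls, each of cost of order a^(-alpha J L) =
    g^(-4JL). The total at level J is O(g^(-2JL)), hence O(g^-J). *)
Lemma hdim_exponential_cover (R : realType) (a alpha delta : R) (N0 L : nat)
    (E : set (cplx R)) (k : nat -> nat) (ctr : nat -> nat -> cplx R) :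
  1 < a -> 0 < alpha -> 0 < delta -> (0 < L)%N ->
  (forall J, (k J)%:R <= N0%:R * (a `^ (alpha / 4)) ^+ (2 * (J * L))) ->
  (forall z, E z -> forall J0, exists J, (J0 <= J)%N /\
     exists2 i, (i < k J)%N & Cdist (ctr J i) z <= delta / a ^+ (J * L)) ->
  (hdim E <= alpha%:E)%E.
Proof.
move=> a1 al0 d0 L0 hk cov; set g := a `^ (alpha / 4).
have a0 : 0 < a := lt_trans ltr01 a1.
have g0 : 0 < g by exact: powR_gt0.
have g1 : 1 < g.
  rewrite /g /powR gt_eqF// -[ltLHS]expR0 ltr_expR.
  by rewrite mulr_gt0 ?divr_gt0// ln_gt0.
have powa m : (a ^+ m) `^ alpha = g ^+ (4 * m).
  rewrite -powR_mulrn ?(ltW a0)// -powRrM -powR_mulrn ?(ltW g0)// /g -powRrM.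
  by congr (_ `^ _); rewrite natrM; field.
have am0 m : 0 < a ^+ m by rewrite exprn_gt0.
apply: (@hdim_limsup_cball R alpha E k ctr (fun J => delta / a ^+ (J * L))
   (N0%:R * (2 * delta) `^ alpha) g^-1) => //.
- by rewrite mulr_ge0// powR_ge0.
- by rewrite invr_ge0 ltW.
- by rewrite invf_lt1.
- by move=> J; rewrite divr_ge0 ?ltW.
- have -> : (fun J => delta / a ^+ (J * L)) = geometric delta (a ^+ L)^-1.
    by apply/funext => J; rewrite /geometric /= exprVn -exprM mulnC.
  by apply: cvg_geometric; rewrite gtr0_norm ?invr_gt0// invf_lt1// exprn_egt1// -lt0n.
move=> J; set m := (J * L)%N.
have g4 : 0 < g ^+ (4 * m) by rewrite exprn_gt0.
have e : (2 * (delta / a ^+ m)) `^ alpha = (2 * delta) `^ alpha / g ^+ (4 * m).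
  have x0 : 0 <= 2 * (delta / a ^+ m) by rewrite ltW// mulr_gt0// divr_gt0.
  have key : (2 * (delta / a ^+ m)) `^ alpha * (a ^+ m) `^ alpha = (2 * delta) `^ alpha.
    by rewrite -powRM ?(ltW (am0 m))// -mulrA divfK ?gt_eqF.
  by rewrite -key powa mulfK ?gt_eqF.
rewrite e; set D := (2 * delta) `^ alpha; have D0 : 0 <= D by exact: powR_ge0.
apply: le_trans (ler_wpM2r (divr_ge0 D0 (ltW g4)) (hk J)) _; rewrite -/g -/m.
rewrite (_ : _ * (D / _) = N0%:R * D * g^-1 ^+ (2 * m)); last first.
  rewrite exprVn (_ : (4 * m = 2 * m + 2 * m)%N); last by rewrite -mulnDl.
  by rewrite exprD; field; rewrite expf_neq0// gt_eqF.
rewrite ler_wpM2l ?mulr_ge0// ler_wiXn2l ?invr_ge0 ?(ltW g0)//.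
  by rewrite invf_le1// ltW.
by rewrite /m; nia.
Qed.

Lemma Cdist_gt0 (R : realType) (z w : cplx R) : z <> w -> 0 < Cdist z w.
Proof.
move=> zw; rewrite lt_def Cdist_ge0 andbT; apply/eqP => h; apply: zw.
have := Cdist_re z w; have := Cdist_im z w; rewrite h !normr_le0 !subr_eq0.
by case: z w {h} => x y [u v] /= /eqP -> /eqP ->.
Qed.

Definition decay_exponent (R : realType) (b pmin rho : R) (e l : nat) : R :=
  - ln (contract_rate pmin rho) / (4 * e%:R * ((4 * l)%:R * ln b)).

Lemma good_parameter_decay (R : realType) N (beta : 'I_N.+1 -> cplx R)
    (a b eta pmin rho : R) (l e J1 : nat) (om : nat -> 'I_N.+1) (th : cplx R) :
  1 < a -> a < b -> (0 < l)%N -> (0 < e)%N -> 0 < pmin -> 0 < rho -> rho <= 8^-1 ->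
  annulus a b eta th ->
  (forall J, (J1 <= J)%N -> (2 * e * runless_count l om J <= J)%N) ->
  (forall J x, (J1 <= J)%N -> admissible beta a b eta th ->
     1 <= Cnorm (orbit beta om (J * (4 * l)) (th, x)) <= b ^+ (4 * l) ->
     (J %/ e < bad_count beta rho l om (th, x) 0 J)%N) ->
  forall (k : 'I_N.+1 -> nat) (lam : 'I_N.+1 -> cplx R)
    (t : 'I_N.+1 -> nat -> cplx R) (p : 'I_N.+1 -> nat -> R),
  planar_model k lam t p ->
  (exists j j', [/\ (j < k ord0)%N, (j' < k ord0)%N & t ord0 j <> t ord0 j']) ->
  (forall j, (j < k ord0)%N -> pmin <= p ord0 j) ->
  (forall i, lam i = contraction beta th i /\ a <= (Cnorm (lam i))^-1 <= b) ->
  forall Q : probability USpace R, coding_law k p om Q ->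
  fourier_decay (law_fourier_abs Q (rpoint lam t om)) (decay_exponent b pmin rho e l).
Proof.
move=> a1 ab l0 e0 pm0 rho0 rho8 ann few bad k lam t p model [j0 [j1 [j0k j1k tne]]] pminP
  lamP Q law.
have elam : lam = contraction beta th by apply/funext => i; have [] := lamP i.
rewrite elam in model lamP *; clear elam lam.
have a0 : 0 < a := lt_trans ltr01 a1.
have b1 : 1 < b := lt_trans a1 ab. have b0 : 0 < b := lt_trans ltr01 b1.
have adm : admissible beta a b eta th.
  by split => // i; have [_] := lamP i; rewrite Cnorm_contraction.
have lam_le i : Cnorm (contraction beta th i) <= a^-1.
  have [_ /andP[h _]] := lamP i; have [/andP[n0 _] _] := model i.
  by rewrite -[leLHS]invrK lef_pV2 ?posrE ?invr_gt0.
have r1 : a^-1 < 1 by rewrite invf_lt1.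
set tau := Cdist (t ord0 j0) (t ord0 j1); have tau0 : 0 < tau by exact: Cdist_gt0.
set sg := decay_exponent _ _ _ _ _.
have c0 := contract_rate_gt0 pmin rho.
have c1 := contract_rate_lt1 pm0 rho0 rho8.
have sg0 : 0 <= sg.
  rewrite /sg /decay_exponent divr_ge0//; first by rewrite oppr_ge0 ln_le0// ltW.
  by rewrite !mulr_ge0// ln_ge0// ltW.
(* Frequencies below this threshold do not reach level J1; for them the trivial bound 1 is at most
   (T0 / |xi|)^sg. The constant may depend on the model, the exponent does not. *)
pose T0 := b ^+ (J1 * (4 * l)) / tau.
have T00 : 0 < T0 by rewrite divr_gt0// exprn_gt0.
pose C1 := expR (- ln (contract_rate pmin rho) / (4 * e%:R)) * tau `^ (- sg).
exists (C1 + T0 `^ sg) => xi xi1.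
have xi0 : 0 < Cnorm xi := lt_le_trans ltr01 xi1.
have C10 : 0 <= C1 by rewrite mulr_ge0 ?expR_ge0 ?powR_ge0.
set F := law_fourier_abs _ _ _; have F0 : 0 <= F by exact: sqrtr_ge0.
pose s := (th, frequency t xi j0 j1).
have sE : Cnorm s.2 = tau * Cnorm xi by rewrite Cnorm_frequency.
have tail1 : 0 <= C1 * Cnorm xi `^ (- sg) by rewrite mulr_ge0 ?powR_ge0.
have tail2 : 0 <= T0 `^ sg * Cnorm xi `^ (- sg) by rewrite mulr_ge0 ?powR_ge0.
rewrite mulrDl; case: (leP (b ^+ (J1 * (4 * l))) (Cnorm s.2)) => big.
  suff FC1 : F <= C1 * Cnorm xi `^ (- sg) by apply: le_trans FC1 _; rewrite lerDl.
  have [J [J1J /andP[ge1 leb] xb]] := select_level om a1 ab l0 (adm : admissible beta a b eta s.1) big.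
  have bc := bad J s.2 J1J adm; rewrite ge1 leb in bc.
  have {}bc := bc isT; have fw := few J J1J.
  have cnt := bad_count_le beta t th om xi j0 j1 rho l J.
  have Fc := fourier_block_decay xi l model law r1 lam_le j0k j1k pm0 pminP rho0 rho8 J.
  (* J < e (runless + contracting) and 2 e runless <= J together give J < 2 e contracting. *)
  have Jc : (J <= 2 * e * contract_count beta t th om xi j0 j1 rho l J)%N.
    have h := ltn_ceil J e0.
    have h2 : (J %/ e < runless_count l om J + contract_count beta t th om xi j0 j1 rho l J)%N.
      exact: leq_trans bc cnt.
    by move: (leq_trans h (leq_mul h2 (leqnn e))) fw; clear; lia.
  have L0 : (0 < 4 * l)%N by rewrite muln_gt0.
  have x0 : 0 < Cnorm s.2 by rewrite sE mulr_gt0.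
  apply: le_trans (power_decay F0 c0 c1 b1 x0 e0 L0 Fc Jc xb) _.
  rewrite sE (powRM _ (ltW tau0) (ltW xi0)) mulrA; exact: lexx.
suff FT0 : F <= T0 `^ sg * Cnorm xi `^ (- sg) by apply: le_trans FT0 _; rewrite lerDr.
apply: le_trans (fourier_le1 xi model law r1 lam_le) _.
rewrite powRN ler_pdivlMr ?powR_gt0// mul1r ge0_ler_powR ?nnegrE ?(ltW T00) ?(ltW xi0)//.
by rewrite /T0 ler_pdivlMr// mulrC -sE ltW.
Qed.

Theorem theorem5p1 (R : realType) (N : nat) (q : 'I_N.+1 -> R)
    (P : probability (OmegaT N) R)
    (a b eta : R) (beta : 'I_N.+1 -> cplx R) (pmin pmax alpha : R) :
  (forall i, 0 < q i) -> \sum_i q i = 1 -> bernoulli_law q P ->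
  1 < a -> a < b -> 0 < eta ->
  beta ord0 = Cone R ->
  (forall kappa, ln a / (ln b + pi) <= Cnorm (beta kappa) <= (ln b + pi) / ln a) ->
  0 < pmin -> pmin <= pmax -> pmax < 1 -> 0 < alpha ->
  exists (G : set (OmegaT N * cplx R)) (sigma : R),
    [/\ measurable G, G `<=` [set x | annulus a b eta x.2], 0 < sigma,
      {ae P, forall omega : OmegaT N,
         (hdim [set theta | annulus a b eta theta /\ ~ G (omega, theta)]
           <= alpha%:E)%E} &
      forall (omega : OmegaT N) (theta : cplx R), G (omega, theta) ->
      forall (k : 'I_N.+1 -> nat) (lam : 'I_N.+1 -> cplx R)
             (t : 'I_N.+1 -> nat -> cplx R) (p : 'I_N.+1 -> nat -> R),
        planar_model k lam t p -> model_nondegenerate P k t ->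
        (2 <= k ord0)%N ->
        (exists j j', [/\ (j < k ord0)%N, (j' < k ord0)%N & t ord0 j <> t ord0 j']) ->
        (forall j, (j < k ord0)%N -> pmin <= p ord0 j <= pmax) ->
        (forall kappa, lam kappa = Cexp (Cmul (Cneg (beta kappa)) (Clog theta))
                       /\ a <= (Cnorm (lam kappa))^-1 <= b) ->
        forall Q : probability USpace R, coding_law k p omega Q ->
          fourier_decay (law_fourier_abs Q (rpoint lam t omega)) sigma].
Proof.
move=> q0 q1 HP a1 ab eta0 beta0 betaP pm0 _ _ al0.
have a0 : 0 < a := lt_trans ltr01 a1.
have b1 : 1 < b := lt_trans a1 ab. have b0 : 0 < b := lt_trans ltr01 b1.
pose M := (ln b + pi) / ln a.
have hM i : Cnorm (beta i) <= M by have /andP[] := betaP i.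
pose B := (Num.truncn (b + 4 * b * (M * (1 + 2 * (b / eta))))).+1.
have hB : b + 4 * b * (M * (1 + 2 * (b / eta))) <= B%:R by exact: ltW (truncnS_gt _).
pose g := a `^ (alpha / 4).
have g1 : 1 < g.
  rewrite /g /powR gt_eqF// -[ltLHS]expR0 ltr_expR.
  by rewrite mulr_gt0 ?divr_gt0// ln_gt0.
(* The weight A makes the positions of the bad blocks cost at most a factor g per block. *)
pose A := (Num.truncn (g - 1)^-1).+1.
have Ag : 1 + A%:R^-1 <= g.
  rewrite -lerBrDl -[leRHS]invrK lef_pV2 ?posrE ?invr_gt0 ?subr_gt0 ?ltr0Sn//.
  exact: ltW (truncnS_gt _).
have [e' he] := expr_unbounded ((9 * B) ^ 4 * A)%:R g1.
pose e := e'.+1.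
have Yg : ((9 * B) ^ 4 * A)%:R <= g ^+ e.
  by apply: le_trans (ltW he) _; apply: ler_weXn2l; [exact: ltW|].
(* The block length comes after e. The factor 2 ensures that runless blocks use up at most half of
   the J / e bad ones. *)
have [l l0 small] := exists_block_length q0 q1 (2 * e).
have BL0 : 0 < B%:R ^+ (4 * l) :> R by rewrite exprn_gt0 ?ltr0Sn.
pose delta : R := (4 * B%:R ^+ (4 * l))^-1.
have d0 : 0 < delta by rewrite invr_gt0 mulr_gt0.
have hd : B%:R ^+ (4 * l) * delta <= 2^-1.
  rewrite /delta invfM mulrCA divff ?gt_eqF// mulr1 lef_pV2 ?posrE ?ltr0Sn//.
  by rewrite ler_nat.
have rc0 := run_const_gt0 b0 eta0.
pose rho := Num.min 8^-1 (delta / (2 * run_const b eta * B%:R ^+ (4 * l))).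
have rho8 : rho <= 8^-1 by rewrite ge_min lexx.
have den0 : 0 < 2 * run_const b eta * B%:R ^+ (4 * l) by rewrite !mulr_gt0.
have rho0 : 0 < rho by rewrite lt_min invr_gt0 ltr0n divr_gt0.
have hrd : B%:R ^+ (4 * l) * (run_const b eta * (2 * rho)) <= delta.
  have assoc (x y z : R) : x * (y * (2 * z)) = z * (2 * y * x) by ring.
  by rewrite assoc -ler_pdivlMr// ge_min lexx orbT.
have [N0 cov] := @bad_parameters_cover R N beta a b eta M rho delta B l A a1 ab eta0 beta0
  hM hB (ltn0Sn _) d0 hd rho8 hrd (ltn0Sn _).
(* A cover is chosen for each finite word, continued by [ord0], so that its balls depend on omega
   only through a prefix. *)
pose P0 (x : seq 'I_N.+1 * nat) (y : nat * (nat -> cplx R)) :=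
  y.1%:R <= N0%:R * ((8 * B ^ (4 * l)).+1 ^ 4 * A)%:R ^+ (x.2 %/ e) * (1 + A%:R^-1) ^+ x.2 :> R /\
  forall th z, level beta a b eta rho l (nth ord0 x.1) x.2 (x.2 %/ e) 0 (th, z) ->
    exists2 i, (i < y.1)%N & Cdist (y.2 i) th <= delta / a ^+ (x.2 * (4 * l)).
have exP0 x : exists y, P0 x y.
  have [k [ctr h]] := cov (nth ord0 x.1) x.2 (x.2 %/ e)%N.
  by exists (k, ctr).
have [f fP] := @boolp.choice _ _ P0 exP0.
pose rad J := delta / a ^+ (J * (4 * l)).
have rad0 J : 0 <= rad J by rewrite ltW// divr_gt0// exprn_gt0.
pose E J (v : seq 'I_N.+1) := \bigcup_(i in `I_((f (v, J)).1)) cball ((f (v, J)).2 i) (rad J).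
pose runless_io := lim_sup_set (@many_runless N (2 * e) l).
have mrunless_io : measurable runless_io.
  apply: bigcap_measurable => // J _; apply: bigcup_measurable => J' _.
  exact: measurable_many_runless.
(* Besides having few runless blocks, theta must escape the covers of all sufficiently large levels.
   Countably many words and closed balls make this measurable, and the excluded parameters form a
   limsup set. *)
pose G : set (OmegaT N * cplx R) := [set x | annulus a b eta x.2] `&` [set x | ~ runless_io x.1] `&`
  \bigcup_J0 \bigcap_(J in [set J | (J0 <= J)%N])
    ~` [set x | E J (mkseq x.1 (J * (4 * l))) x.2].
exists G, (decay_exponent b pmin rho e l); split.
- apply: measurableI; first apply: measurableI.
  + have := @measurable_snd _ _ (OmegaT N) _ measurableT _
      (measurable_annulus eta (ltW a0) (ltW b0)).
    by rewrite setTI.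
  + have := @measurable_fst _ _ _ (R * R)%type measurableT _ (measurableC mrunless_io).
    by rewrite setTI.
  apply: bigcupT_measurable => J0; apply: bigcap_measurable => [|J _]; first by exists J0 => /=.
  apply: measurableC; apply: (@measurable_words R N _ (E J)) => v.
  by apply: bigcup_measurable => i _; apply: measurable_cball.
- by move=> x [[]].
- rewrite divr_gt0//; first by rewrite oppr_gt0 ln_lt0// contract_rate_gt0 contract_rate_lt1.
  by rewrite !mulr_gt0 ?ltr0n ?muln_gt0 ?ln_gt0.
- exists runless_io; split => //; first refine (few_runless q0 q1 HP small).
  move=> om; apply: contra_notP => not_io.
  pose v J := mkseq om (J * (4 * l)).
  apply: (@hdim_exponential_cover R a alpha delta N0 (4 * l) _
     (fun J => (f (v J, J)).1) (fun J => (f (v J, J)).2)) => //.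
  + by rewrite muln_gt0.
  + move=> J; have [h _] := fP (v J, J); apply: le_trans h _ => /=.
    rewrite -mulrA ler_wpM2l//.
    by apply: cover_growth => //; [exact: ltW|rewrite muln_gt0].
  move=> z [az nG] J0; apply: contrapT => h; apply: nG; split; first by split.
  exists J0 => // J JJ [i ik zi]; apply: h; exists J; split => //.
  by exists i.
move=> om th [[ann not_io] [J0 _ hE]] k lam t p model _ _ tne pP lamP Q law.
have [J2 hJ2] : exists J2, forall J, (J2 <= J)%N -> (2 * e * runless_count l om J <= J)%N.
  apply: contrapT => h; apply: not_io => J2 _; apply: contrapT => h'; apply: h.
  exists J2 => J JJ; rewrite leqNgt; apply/negP => bad; apply: h'.
  by exists J.
apply: (@good_parameter_decay R N beta a b eta pmin rho l e (maxn J0 J2) om th) => //.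
- by move=> J; rewrite geq_max => /andP[_]; exact: hJ2.
(* Whatever the frequency x, too few bad blocks would place theta in a ball of the cover attached to
   its prefix, which membership in [G] forbids. *)
- move=> J x; rewrite geq_max => /andP[JJ _] adm lev; rewrite ltnNge; apply/negP => cnt.
  have eq_om m : (m < J * (4 * l))%N -> om m = nth ord0 (mkseq om (J * (4 * l))) m.
    by move=> mJ; rewrite nth_mkseq.
  have [_ h] := fP (mkseq om (J * (4 * l)), J).
  have [|i ik zi] := h th x; last by apply: (hE J JJ); exists i.
  split => //=; first by rewrite -(eq_orbit beta _ eq_om).
  by rewrite -(eq_bad_count _ _ _ eq_om).
- by move=> j /pP/andP[].
Qed.
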